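(* Let $\alpha>-1$ and let $\{a_k\}_k\subset\mathbb B^n$ be a separated sequence. If there exists $m>0$ such that $K(\{a_k\},m,n+1+\alpha)<1$, then $\{a_k\}$ is an interpolating sequence for $B^1_\alpha$.
   Context: $\mathbb B^n$ is the unit ball of $\mathbb C^n$, $z\bar w=\sum_j z_j\bar w_j$; $d(a,b)=|\varphi_a(b)|$ is the invariant distance, with $1-d(a,b)^2=\frac{(1-|a|^2)(1-|b|^2)}{|1-a\bar b|^2}$; a sequence is separated if there is $\delta>0$ with $d(a_j,a_k)\ge\delta$ for $j\ne k$. For $p,q>0$, $K(\{a_k\},p,q)=\sup_k\sum_{j\ne k}\frac{(1-|a_k|^2)^p(1-|a_j|^2)^q}{|1-\bar a_k a_j|^{p+q}}$. $B^1_\alpha$ is the space of holomorphic $f$ on $\mathbb B^n$ with $\|f\|_{1,\alpha}=\int_{\mathbb B^n}(1-|z|^2)^\alpha|f|\,dm<\infty$. A sequence is interpolating for $B^1_\alpha$ if for every complex sequence $v$ with $\sum_k(1-|a_k|^2)^{n+1+\alpha}|v_k|<\infty$ there is $f\in B^1_\alpha$ with $f(a_k)=v_k$ for all $k$. *)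

(* Defs.v *)
From HB Require Import structures.
From mathcomp Require Import all_boot all_order all_algebra.
From mathcomp Require Import all_classical all_reals all_analysis.
From mathcomp Require Import complex.
Set Implicit Arguments. Unset Strict Implicit. Unset Printing Implicit Defensive.
Import Order.TTheory GRing.Theory Num.Theory.
Local Open Scope ring_scope.

Section Defs.
Variable R : realType.

Local Notation C := (complex R).

Definition cabs (w : C) : R := let: Complex x y := w in Num.sqrt (x ^+ 2 + y ^+ 2).

Definition cconj (w : C) : C := let: Complex x y := w in Complex x (- y).

Definition hdot (n : nat) (z w : 'rV[C]_n) : C :=
  \sum_(j < n) z ord0 j * cconj (w ord0 j).

Definition vnorm2 (n : nat) (z : 'rV[C]_n) : R := \sum_(j < n) cabs (z ord0 j) ^+ 2.
Definition vnorm (n : nat) (z : 'rV[C]_n) : R := Num.sqrt (vnorm2 z).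

Definition ball_n (n : nat) : set 'rV[C]_n := [set z | vnorm2 z < 1].

(* invariant (pseudo-hyperbolic) distance d(a,b) = |phi_a(b)|, given by
   1 - d(a,b)^2 = (1-|a|^2)(1-|b|^2)/|1 - a \bar b|^2 *)
Definition inv_dist (n : nat) (a b : 'rV[C]_n) : R :=
  Num.sqrt (1 - (1 - vnorm2 a) * (1 - vnorm2 b) / cabs (1 - hdot a b) ^+ 2).

Definition separated_seq (n : nat) (a : nat -> 'rV[C]_n) : Prop :=
  exists2 delta : R, 0 < delta &
    forall j k : nat, j <> k -> delta <= inv_dist (a j) (a k).

(* K({a_k}, p, q) = sup_k sum_{j <> k} (1-|a_k|^2)^p (1-|a_j|^2)^q / |1 - \bar a_k a_j|^(p+q),
   as an extended real (the series have nonnegative terms). *)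
Definition Kterm (n : nat) (a : nat -> 'rV[C]_n) (p q : R) (k j : nat) : R :=
  (1 - vnorm2 (a k)) `^ p * (1 - vnorm2 (a j)) `^ q
  / cabs (1 - hdot (a j) (a k)) `^ (p + q).

Definition Kconst (n : nat) (a : nat -> 'rV[C]_n) (p q : R) : \bar R :=
  ereal_sup [set (\sum_(j <oo | j != k) (Kterm a p q k j)%:E)%E | k in [set: nat]].

Definition holomorphic_on (n : nat) (D : set 'rV[C]_n) (f : 'rV[C]_n -> C) : Prop :=
  forall z, D z -> exists c : 'rV[C]_n,
    forall eps : R, 0 < eps -> exists2 del : R, 0 < del &
      forall h : 'rV[C]_n, vnorm h < del ->
        cabs (f (z + h) - f z - \sum_(j < n) c ord0 j * h ord0 j) <= eps * vnorm h.

(* Lebesgue integral over R^N of a nonnegative extended-real function of the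
   coordinates x_0, ..., x_(N-1), computed as an iterated Lebesgue integral
   (Tonelli); [iint N g x] integrates out the coordinates 0..N-1 of x. *)
Fixpoint iint (N : nat) (g : (nat -> R) -> \bar R) (x : nat -> R) : \bar R :=
  match N with
  | 0 => g x
  | N'.+1 => (\int[lebesgue_measure]_(t in [set: R])
                iint N' g (fun i => if i == N' then t else x i))%E
  end.

Definition cvec_of (n : nat) (x : nat -> R) : 'rV[C]_n :=
  \row_(j < n) Complex (x (2 * j)%N) (x (2 * j + 1)%N).

Definition ball_integral (n : nat) (g : 'rV[C]_n -> R) : \bar R :=
  iint (2 * n) (fun x => ((\1_(@ball_n n) (@cvec_of n x) : R) * g (@cvec_of n x))%:E)
       (fun _ => 0).

Definition bergman1 (n : nat) (alpha : R) (f : 'rV[C]_n -> C) : Prop :=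
  holomorphic_on (@ball_n n) f /\
  (ball_integral (fun z => ((1 - vnorm2 z) `^ alpha * cabs (f z))%R) < +oo)%E.

Definition interpolating_B1 (n : nat) (alpha : R) (a : nat -> 'rV[C]_n) : Prop :=
  forall v : nat -> C,
    (\sum_(k <oo) ((1 - vnorm2 (a k)) `^ (n%:R + 1 + alpha) * cabs (v k))%R%:E < +oo)%E ->
    exists f : 'rV[C]_n -> C, bergman1 alpha f /\ forall k, f (a k) = v k.

End Defs.

(* Main.v *)
Require Import Defs.
From HB Require Import structures.
From mathcomp Require Import all_boot all_order all_algebra.
From mathcomp Require Import all_classical all_reals all_analysis.
From mathcomp Require Import complex.
From mathcomp Require Import measurable_realfun.
From mathcomp Require Import ring lra zify.
Set Implicit Arguments. Unset Strict Implicit. Unset Printing Implicit Defensive.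
Import Order.TTheory GRing.Theory Num.Theory.
Import numFieldNormedType.Exports.
Local Open Scope classical_set_scope.
Local Open Scope ring_scope.

(** With N = n + 1 + alpha and s = N + m, put
    F_j(z) = ((1 - |a_j|^2) / (1 - z.conj(a_j)))^s, so that F_j(a_j) = 1.  On sequences with
    norm sum_k (1 - |a_k|^2)^N |w_k|, the matrix (F_j(a_k)) is the identity plus an
    off-diagonal part whose norm is at most K({a_k}, m, N) < 1, so a Neumann series gives w with
    sum_j w_j F_j(a_k) = v_k for all k, and f = sum_j w_j F_j interpolates v.

    f is holomorphic because the second-order Taylor remainders of the F_j at a point of the
    ball are bounded uniformly in j.  It is in B^1_alpha by the Forelli-Rudin estimate: the
    integral of (1 - |z|^2)^alpha |1 - z.conj(a)|^(-s) is at most c (1 - |a|^2)^(-m).  To prove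
    it, a is moved onto a coordinate axis by Givens rotations, which preserve iterated integrals
    since they are products of shears (translation invariance) and coordinate swaps (Tonelli);
    the real coordinates are then integrated out one at a time. *)

(** * Iterated integrals *)

(** The weight (1 - |a_k|^2)^N serves both halves of the argument. The sum over k <> j of (1 -
    |a_k|^2)^N |F_j(a_k)| is (1 - |a_j|^2)^N times one of the sums in [Kconst] with p = m, and the
    norm of F_j in B^1_alpha is O((1 - |a_j|^2)^(s - m)), which is again (1 - |a_j|^2)^N. Hence the
    choice s = N + m.

    [ball_integral] is an iterated integral, coordinate 0 innermost, and not an integral against a
    product measure. A unitary change of variables therefore has to be factored into maps that
    translate one coordinate or exchange two neighbours. The same order of integration fixes the
    target of the rotation: [a] goes to the last complex coordinate, so that the kernel is constant
    along all coordinates integrated before it. Only upper bounds matter, so comparison with pure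
    powers replaces the Beta and hypergeometric functions of an exact computation. *)

Section integral_facts.
Context {R : realType}.
Local Notation mu := (@lebesgue_measure R).

(** The integral of a nonnegative function is a supremum over the simple functions below it, so
    monotonicity holds for arbitrary functions. This allows integrands built from [synth] to be
    bounded although their measurability is never established. *)
Lemma le_integral_ge0 d (T : measurableType d) (nu : {measure set T -> \bar R})
    (f g : T -> \bar R) : (forall x, (0 <= f x)%E) -> (forall x, (f x <= g x)%E) ->
  (\int[nu]_x f x <= \int[nu]_x g x)%E.
Proof.
move=> f0 fg; rewrite !ge0_integralTE//; last by move=> x; exact: le_trans (fg x).
apply: le_ereal_sup => _ [h hf <-]; exists h => // x.
by apply: le_trans (fg x); exact: hf.
Qed.

Lemma measurable_addr (c : R) : measurable_fun setT (fun t : R => t + c).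
Proof. by exact: measurable_funD. Qed.

Let addT (c : R) : R -> measurableTypeR R := fun t => t + c.

Let lebesgue_measure_shift c (A : set R) : measurable A ->
  pushforward mu (addT c) A = mu A.
Proof.
move=> mA; apply/esym/lebesgue_measure_unique => //=; first exact: measurable_addr.
move=> mp _ [[a b]] _ <-; rewrite /pushforward /=.
have -> : addT c @^-1` `]a, b] = `](a - c), (b - c)]%classic.
  by apply/seteqP; split => t /=; rewrite /addT !in_itv/= ltrBlDr lerBrDr.
rewrite !lebesgue_measure_itv/= !lte_fin ltrD2r; case: ifPn => // _.
by rewrite -!EFinD; congr EFin; ring.
Qed.

Lemma lebesgue_integral_shift (f : R -> \bar R) (c : R) : measurable_fun setT f ->
  (forall t, (0 <= f t)%E) -> (\int[mu]_t f (t + c)%R = \int[mu]_t f t)%E.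
Proof.
move=> mf f0; rewrite -[LHS]/(\int[mu]_(t in addT c @^-1` setT) (f \o addT c) t)%E.
rewrite -ge0_integral_pushforward//=; last exact: measurable_addr.
apply: eq_measure_integral; first exact: measurable_addr.
by move=> mp A mA _; exact: lebesgue_measure_shift.
Qed.

Lemma lebesgue_integral_opp (f : R -> \bar R) : measurable_fun setT f ->
  (forall t, (0 <= f t)%E) -> (\int[mu]_t f (- t)%R = \int[mu]_t f t)%E.
Proof.
move=> mf f0.
rewrite -[LHS]/(\int[mu]_(t in (-%R : _ -> measurableTypeR R) @^-1` setT) (f \o -%R) t)%E.
rewrite -ge0_integral_pushforward//=.
by apply: eq_measure_integral => //= A mA _; exact: lebesgue_measureN.
Qed.

End integral_facts.

Definition upd T (x : nat -> T) (k : nat) (t : T) : nat -> T :=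
  fun i => if i == k then t else x i.

Section iterated.
Context {R : realType}.
Local Notation mu := (@lebesgue_measure R).
Local Notation seqR := (nat -> R).

Lemma iintS k g x : iint k.+1 g x = (\int[mu]_t iint k g (upd x k t))%E.
Proof. by []. Qed.

(* Joint measurability on [nat -> R], phrased by testing against every family of measurable
   coordinates, so that no sigma-algebra on the sequence space is needed. *)
Definition cmeasurable d' (Y : measurableType d') (g : seqR -> Y) : Prop :=
  forall d (T : measurableType d) (phi : T -> seqR),
    (forall i, measurable_fun setT (fun t => phi t i)) ->
    measurable_fun setT (fun t => g (phi t)).

Lemma cmeasurable_coord i : cmeasurable (fun x : seqR => x i).
Proof. by move=> d T phi; exact. Qed.

Lemma cmeasurable_upd d' (Y : measurableType d') (g : seqR -> Y) x k :
  cmeasurable g -> measurable_fun setT (fun t => g (upd x k t)).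
Proof.
by move=> mg; apply: mg => i; rewrite /upd; case: eqP => // _; exact: measurable_id.
Qed.

Lemma cmeasurable_comp d' (Y : measurableType d') (g : seqR -> Y) (S : seqR -> seqR) :
  cmeasurable g -> (forall i, cmeasurable (fun x => S x i)) -> cmeasurable (g \o S).
Proof. by move=> mg mS d T phi mphi; apply: mg => i; exact: mS. Qed.

Lemma iint_ge0 k (g : seqR -> \bar R) : (forall x, (0 <= g x)%E) ->
  forall x, (0 <= iint k g x)%E.
Proof.
by move=> g0; elim: k => [|k IH] x //; rewrite iintS; apply: integral_ge0 => t _.
Qed.

Lemma le_iint k (f g : seqR -> \bar R) : (forall x, (0 <= f x)%E) ->
  (forall x, (f x <= g x)%E) -> forall x, (iint k f x <= iint k g x)%E.
Proof.
move=> f0 fg; elim: k => [|k IH] x //; rewrite !iintS.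
by apply: le_integral_ge0 => t //; exact: iint_ge0.
Qed.

Lemma cmeasurable_iint k (g : seqR -> \bar R) : cmeasurable g ->
  (forall x, (0 <= g x)%E) -> cmeasurable (iint k g).
Proof.
move=> mg g0; elim: k => [|k IH] //= d T phi mphi.
pose F (p : T * measurableTypeR R) := iint k g (upd (phi p.1) k p.2).
have mF : measurable_fun setT F.
  apply: IH => i; rewrite /upd; case: eqP => _; first exact: measurable_snd.
  by apply: (measurableT_comp (mphi i)); exact: measurable_fst.
have F0 p : (0 <= F p)%E by exact: iint_ge0.
exact: (@measurable_fun_fubini_tonelli_F _ _ T (measurableTypeR R) R mu F mF F0).
Qed.

Lemma iint_nneseries k (g : nat -> seqR -> \bar R) :
  (forall j, cmeasurable (g j)) -> (forall j x, (0 <= g j x)%E) ->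
  forall x, iint k (fun y => \sum_(j <oo) g j y)%E x = (\sum_(j <oo) iint k (g j) x)%E.
Proof.
move=> mg g0; elim: k => [|k IH] x //; rewrite iintS.
under eq_integral do rewrite IH.
rewrite integral_nneseries// => j.
- by apply: cmeasurable_upd; exact: cmeasurable_iint.
- by move=> t _; exact: iint_ge0.
Qed.

Lemma iintZl k (c : R) (g : seqR -> \bar R) : 0 <= c -> cmeasurable g ->
  (forall x, (0 <= g x)%E) ->
  forall x, iint k (fun y => c%:E * g y)%E x = (c%:E * iint k g x)%E.
Proof.
move=> c0 mg g0; elim: k => [|k IH] x //; rewrite !iintS.
under eq_integral do rewrite IH.
rewrite ge0_integralZl//.
- by apply: cmeasurable_upd; exact: cmeasurable_iint.
- by move=> t _; exact: iint_ge0.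
Qed.

End iterated.

(** * Rotations preserve iterated integrals *)

Section isometries.
Context {R : realType}.
Local Notation mu := (@lebesgue_measure R).
Local Notation seqR := (nat -> R).

Definition swap_adj (k : nat) (x : seqR) : seqR := upd (upd x k (x k.+1)) k.+1 (x k).
Definition shear_up (k : nat) (c : R) (x : seqR) : seqR := upd x k (x k + c * x k.+1).
Definition rotation (k : nat) (c s : R) (x : seqR) : seqR :=
  upd (upd x k (c * x k + s * x k.+1)) k.+1 (- s * x k + c * x k.+1).

Lemma upd_same T (x : nat -> T) k t : upd x k t k = t.
Proof. by rewrite /upd eqxx. Qed.

Lemma upd_other T (x : nat -> T) k t i : i != k -> upd x k t i = x i.
Proof. by rewrite /upd => /negbTE ->. Qed.

Lemma upd_upd T (x : nat -> T) k s t : upd (upd x k s) k t = upd x k t.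
Proof. by apply/funext => i; rewrite /upd; case: eqP. Qed.

Lemma updC T (x : nat -> T) k l s t : k != l -> upd (upd x k s) l t = upd (upd x l t) k s.
Proof.
by move=> kl; apply/funext => i; rewrite /upd; case: eqP => // ->; rewrite eq_sym (negbTE kl).
Qed.

Definition iint_preserving (N : nat) (S : seqR -> seqR) : Prop :=
  (forall i, cmeasurable (fun x => S x i)) /\
  (forall g : seqR -> \bar R, cmeasurable g -> (forall x, (0 <= g x)%E) ->
     forall x, iint N (g \o S) x = iint N g x).

Lemma iint_preserving_comp N S1 S2 :
  iint_preserving N S1 -> iint_preserving N S2 -> iint_preserving N (S1 \o S2).
Proof.
move=> [m1 i1] [m2 i2]; split=> [i|g mg g0 x].
  exact: (cmeasurable_comp (m1 i) m2).
rewrite -[LHS]/(iint N ((g \o S1) \o S2) x) i2 ?i1 //.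
- exact: cmeasurable_comp.
- by move=> y /=.
Qed.

(** When [S] commutes with changes of the inner coordinates, integrating these out passes through
    [S]. A statement about a swap or a shear thus reduces to the one or two coordinates that it
    moves. *)
Lemma iint_comp_upd k (g : seqR -> \bar R) (S : seqR -> seqR) :
  (forall l x t, (l < k)%N -> S (upd x l t) = upd (S x) l t) ->
  forall x, iint k (g \o S) x = iint k g (S x).
Proof.
elim: k => [//|k IH] Su x; rewrite !iintS.
apply: eq_integral => t _; rewrite IH; last by move=> l y s lk; rewrite Su// ltnS ltnW.
by rewrite Su.
Qed.

Lemma eq_iint_le k N (f g : seqR -> \bar R) : (k <= N)%N ->
  (forall x, iint k f x = iint k g x) -> forall x, iint N f x = iint N g x.
Proof.
move=> kN fg; elim: N kN => [|N IH]; first by rewrite leqn0 => /eqP <-.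
rewrite leq_eqVlt => /predU1P[<-//|]; rewrite ltnS => kN x.
by rewrite !iintS; apply: eq_integral => t _; exact: IH.
Qed.

Lemma iint_preserving_swap k N : (k.+1 < N)%N -> iint_preserving N (swap_adj k).
Proof.
move=> kN; split=> [i|g mg g0].
  rewrite /swap_adj /upd; case: eqP => _; first exact: cmeasurable_coord.
  by case: eqP => _; exact: cmeasurable_coord.
apply: (eq_iint_le kN) => x; rewrite !iintS.
have E s t : iint k (g \o swap_adj k) (upd (upd x k.+1 s) k t) =
    iint k g (upd (upd x k.+1 t) k s).
  have ne (a b : nat) : (a < b)%N -> (a != b) /\ (b != a) by lia.
  have [k1 k1'] := ne _ _ (ltnSn k).
  rewrite iint_comp_upd; last first.
    move=> l y r lk; have [lk1 lk2] := ne _ _ lk; have [lk3 lk4] := ne _ _ (ltnW lk : l < k.+1)%N.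
    by rewrite /swap_adj !(upd_other _ _ lk2) !(upd_other _ _ lk4) (updC _ _ _ lk1) (updC _ _ _ lk3).
  congr iint; rewrite /swap_adj !(upd_same, upd_other _ _ k1, upd_other _ _ k1').
  by rewrite upd_upd [LHS]updC// upd_upd updC.
under eq_integral do (rewrite iintS; under eq_integral do rewrite E).
under [RHS]eq_integral do rewrite iintS.
pose F (p : measurableTypeR R * measurableTypeR R) :=
  iint k g (upd (upd x k.+1 p.2) k p.1).
have mF : measurable_fun setT F.
  apply: cmeasurable_iint => // i; rewrite /upd.
  case: eqP => _; first exact: measurable_fst.
  by case: eqP => _ //; exact: measurable_snd.
have F0 p : (0 <= F p)%E by exact: iint_ge0.
exact: (@fubini_tonelli _ _ (measurableTypeR R) (measurableTypeR R) R mu mu F mF F0).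
Qed.

(** Coordinate [k] is integrated while [k.+1] is held fixed, so the shear acts as a translation by a
    constant. The opposite shear would move the outer of the two coordinates; it is reached by
    conjugating with [swap_adj]. *)
Lemma iint_preserving_shear_up k c N : (k.+1 < N)%N -> iint_preserving N (shear_up k c).
Proof.
move=> kN; split=> [i|g mg g0].
  rewrite /shear_up /upd; case: eqP => _; last exact: cmeasurable_coord.
  move=> d T phi mphi; apply: measurable_funD => //.
  by apply: measurable_funM.
apply: (eq_iint_le (ltnW kN)) => x; rewrite !iintS.
under eq_integral => t _.
  rewrite iint_comp_upd; last first.
    move=> l y r lk; rewrite /shear_up !upd_other; try lia.
    by rewrite updC//; lia.
  rewrite /shear_up upd_same upd_other; last lia.
  by rewrite upd_upd; over.
rewrite (lebesgue_integral_shift (f := fun t => iint k g (upd x k t)))//.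
- by apply: cmeasurable_upd; exact: cmeasurable_iint.
- by move=> t; exact: iint_ge0.
Qed.

(** A plane rotation is a product of three shears: two equal ones with coefficient s / (1 + c), the
    tangent of the half angle, around an opposite one with coefficient -s. The condition [0 <= c]
    keeps 1 + c away from zero. *)
Lemma iint_preserving_rotation k c s N : (k.+1 < N)%N -> c ^+ 2 + s ^+ 2 = 1 -> 0 <= c ->
  iint_preserving N (rotation k c s).
Proof.
move=> kN cs c0; have c1 : 1 + c != 0 by apply: lt0r_neq0; lra.
pose U := shear_up k (s / (1 + c)).
pose L := swap_adj k \o shear_up k (- s) \o swap_adj k.
have -> : rotation k c s = U \o L \o U.
  apply/funext => x; apply/funext => i.
  have k1 : (k == k.+1) = false by lia.
  have k2 : (k.+1 == k) = false by lia.
  have E : s ^+ 2 = (1 - c) * (1 + c) by rewrite -[s ^+ 2](addKr (c ^+ 2)) cs; ring.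
  have E2 : c = 1 - s * (s / (1 + c)) by rewrite mulrA -expr2 E mulfK//; ring.
  have E3 : s = (1 + c) * (s / (1 + c)) by field.
  rewrite /= /rotation /U /L /shear_up /swap_adj /upd /=.
  set t := s / (1 + c) in E2 E3 *; clearbody t.
  move: (x k) (x k.+1) => x0 x1.
  case: (eqVneq i k) => [ik|ik]; last case: (eqVneq i k.+1) => [ik1|ik1].
  - rewrite ik k1; transitivity ((1 - s * t) * x0 + (1 + (1 - s * t)) * t * x1).
      by rewrite -E2 -E3.
    by rewrite !eqxx k2; ring.
  - rewrite !eqxx k1 k2; transitivity (- s * x0 + (1 - s * t) * x1).
      by rewrite -E2.
    by ring.
  - by [].
have pU : iint_preserving N U by exact: iint_preserving_shear_up.
apply: iint_preserving_comp => //; apply: iint_preserving_comp => //.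
apply: iint_preserving_comp; last exact: iint_preserving_swap.
apply: iint_preserving_comp; first exact: iint_preserving_swap.
exact: iint_preserving_shear_up.
Qed.

Lemma eq_sum_adj (V : nmodType) (F G : nat -> V) k n : (k.+1 < n)%N ->
  (forall i, i != k -> i != k.+1 -> F i = G i) -> F k + F k.+1 = G k + G k.+1 ->
  \sum_(i < n) F i = \sum_(i < n) G i.
Proof.
move=> kn FG E; elim: n kn => // n IH; rewrite ltnS leq_eqVlt => /predU1P[<-|kn].
  rewrite !big_ord_recr/= -!addrA E; congr (_ + _); apply: eq_bigr => i _.
  by apply: FG; have := ltn_ord i; lia.
by rewrite !big_ord_recr/= IH//; congr (_ + _); apply: FG; lia.
Qed.

Definition sumsq (N : nat) (x : seqR) : R := \sum_(i < N) x i ^+ 2.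

Definition isometry_on (N : nat) (S : seqR -> seqR) : Prop :=
  iint_preserving N S /\ forall x, sumsq N (S x) = sumsq N x.

Lemma isometry_on_comp N S1 S2 :
  isometry_on N S1 -> isometry_on N S2 -> isometry_on N (S1 \o S2).
Proof.
move=> [p1 q1] [p2 q2]; split; first exact: iint_preserving_comp.
by move=> x; rewrite /= q1 q2.
Qed.

Lemma isometry_on_swap k N : (k.+1 < N)%N -> isometry_on N (swap_adj k).
Proof.
move=> kN; split; first exact: iint_preserving_swap.
move=> x; apply: (@eq_sum_adj _ (fun i => swap_adj k x i ^+ 2) (fun i => x i ^+ 2) k _ kN) => [i ik ik1|].
  by rewrite /swap_adj !upd_other.
by rewrite /swap_adj upd_same upd_other ?upd_same; [rewrite addrC|lia].
Qed.

Lemma isometry_on_rotation k c s N : (k.+1 < N)%N -> c ^+ 2 + s ^+ 2 = 1 -> 0 <= c ->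
  isometry_on N (rotation k c s).
Proof.
move=> kN cs c0; split; first exact: iint_preserving_rotation.
move=> x; apply: (@eq_sum_adj _ (fun i => rotation k c s x i ^+ 2) (fun i => x i ^+ 2) k _ kN) => [i ik ik1|].
  by rewrite /rotation !upd_other.
rewrite /rotation upd_same upd_other ?upd_same; last lia.
transitivity ((c ^+ 2 + s ^+ 2) * (x k ^+ 2 + x k.+1 ^+ 2)); first by ring.
by rewrite cs mul1r.
Qed.

Local Notation C := (complex R).

(* [hdot z b] with [z] read off the real coordinates [x]. *)
Definition lform (n : nat) (b : nat -> C) (x : seqR) : C :=
  \sum_(j < n) Complex (x (2 * j)%N) (x (2 * j + 1)%N) * cconj (b j).

(** The angle that annihilates one of two real coefficients. The sign [g] is chosen to make [c]
    nonnegative, as [iint_preserving_rotation] requires; in exchange [r] may be negative and only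
    its square is prescribed. *)
Lemma unit_combination (p q : R) : exists c s r : R,
  [/\ c ^+ 2 + s ^+ 2 = 1, 0 <= c, s * p + c * q = 0, c * p - s * q = r & r ^+ 2 = p ^+ 2 + q ^+ 2].
Proof.
have [pq0|pq0] := eqVneq (p ^+ 2 + q ^+ 2) 0.
  have [/eqP p0 /eqP q0] : p == 0 /\ q == 0.
    by move/eqP: pq0; rewrite paddr_eq0 ?sqr_ge0// !sqrf_eq0 => /andP[].
  by exists 1, 0, 0; rewrite p0 q0; split; rewrite ?(expr1n, expr0n, mulr0, mul0r, addr0, subr0, ler01).
have m20 : 0 < p ^+ 2 + q ^+ 2 by rewrite lt_neqAle eq_sym pq0 addr_ge0 ?sqr_ge0.
pose m := Num.sqrt (p ^+ 2 + q ^+ 2).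
have m0 : 0 < m by rewrite sqrtr_gt0.
have mE : m ^+ 2 = p ^+ 2 + q ^+ 2 by rewrite sqr_sqrtr// ltW.
pose g : R := if 0 <= p then 1 else -1.
have gE : g ^+ 2 = 1 by rewrite /g; case: ifP; rewrite ?sqrrN expr1n.
have mn0 := lt0r_neq0 m0.
exists (g * p / m), (- (g * q) / m), (g * m); split.
- transitivity (g ^+ 2 * (p ^+ 2 + q ^+ 2) / m ^+ 2); first by field.
  by rewrite gE mE mul1r divff.
- apply: divr_ge0; last exact: ltW.
  rewrite /g; case: ifPn => [p0|]; first by rewrite mul1r.
  by rewrite -ltNge => /ltW p0; rewrite mulN1r oppr_ge0.
- by field.
- transitivity (g * (p ^+ 2 + q ^+ 2) / m); first by field.
  by rewrite -mE; field.
- by rewrite exprMn gE mul1r.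
Qed.

(** Rotating the plane of the real and imaginary parts of z_j multiplies z_j by a unimodular number,
    chosen here to make its coefficient real. *)
Lemma lform_phase n j (b : nat -> C) : (j < n)%N -> exists S (r : R),
  [/\ isometry_on (2 * n) S, forall x, lform n b (S x) = lform n (upd b j (Complex r 0)) x &
   r ^+ 2 = cabs (b j) ^+ 2].
Proof.
move=> jn; case bj : (b j) => [p q].
have [c [s [r [cs c0 E1 E2 rE]]]] := unit_combination p q.
exists (rotation (2 * j) c s), r; split.
- by apply: isometry_on_rotation => //; lia.
- move=> x; apply: eq_bigr => i _.
  have [ij|ij] := eqVneq (i : nat) j.
    rewrite ij upd_same bj /rotation addn1 upd_same upd_other ?upd_same; last lia.
    set u := x _; set v := x _; apply/eqP; rewrite eq_complex /=; apply/andP; split; apply/eqP.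
      transitivity (u * (c * p - s * q) + v * (s * p + c * q)); first by ring.
      by rewrite E1 E2; ring.
    transitivity (v * (c * p - s * q) - u * (s * p + c * q)); first by ring.
    by rewrite E1 E2; ring.
  by rewrite upd_other// /rotation !upd_other//; lia.
- by rewrite /= sqr_sqrtr ?rE// addr_ge0 ?sqr_ge0.
Qed.

(** Between two real coefficients the unitary rotation is real: it acts in the same way on the pair
    of real parts and on the pair of imaginary parts. *)
Lemma lform_givens n j (b : nat -> C) (r1 r2 : R) : (j.+1 < n)%N ->
  b j = Complex r1 0 -> b j.+1 = Complex r2 0 -> exists S (r : R),
  [/\ isometry_on (2 * n) S,
   forall x, lform n b (S x) = lform n (upd (upd b j 0) j.+1 (Complex r 0)) x &
   r ^+ 2 = r1 ^+ 2 + r2 ^+ 2].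
Proof.
move=> jn bj bj1.
have [c [s [r [cs c0 E1 E2 rE]]]] := unit_combination r2 (- r1).
(* Only neighbouring coordinates can be rotated. Exchanging positions 2j + 1 and 2j + 2 brings the
   two real parts side by side, and likewise the two imaginary parts; the last swap restores the
   order. *)
exists (swap_adj (2 * j + 1) \o rotation (2 * j) c s \o rotation (2 * j + 2) c s \o
   swap_adj (2 * j + 1)), r; split.
- apply: isometry_on_comp; last by apply: isometry_on_swap; lia.
  apply: isometry_on_comp; last by apply: isometry_on_rotation => //; lia.
  apply: isometry_on_comp; last by apply: isometry_on_rotation => //; lia.
  by apply: isometry_on_swap; lia.
- move=> x; set y := (_ \o _) x.
  pose F (b : nat -> C) x j := Complex (x (2 * j)%N) (x (2 * j + 1)%N : R) * cconj (b j).
  apply: (@eq_sum_adj _ (F b y) (F (upd (upd b j 0) j.+1 (Complex r 0)) x) j _ jn).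
    move=> i ij ij1; rewrite /F !upd_other// /y /= /swap_adj /rotation.
    by rewrite !upd_other//; lia.
  have yE : [/\ y (2 * j)%N = c * x (2 * j)%N + s * x (2 * j + 2)%N,
      y (2 * j + 1)%N = c * x (2 * j + 1)%N + s * x (2 * j + 3)%N,
      y (2 * j + 2)%N = - s * x (2 * j)%N + c * x (2 * j + 2)%N &
      y (2 * j + 3)%N = - s * x (2 * j + 1)%N + c * x (2 * j + 3)%N].
    rewrite /y /= /swap_adj /rotation /upd; move: (2 * j)%N => m.
    rewrite !(addn1, addn2, addn3).
    have e1 : (m == m.+1) = false by lia.
    have e2 : (m == m.+2) = false by lia.
    have e3 : (m == m.+3) = false by lia.
    have e4 : (m.+1 == m) = false by lia.
    have e5 : (m.+2 == m) = false by lia.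
    have e6 : (m.+3 == m) = false by lia.
    by rewrite !(eqSS, eqxx, e1, e2, e3, e4, e5, e6).
  have [y0 y1 y2 y3] := yE.
  rewrite /F upd_same upd_other; last lia. 
  rewrite upd_same bj bj1.
  rewrite (_ : 2 * j.+1 = 2 * j + 2)%N; last lia.
  rewrite (_ : 2 * j + 2 + 1 = 2 * j + 3)%N; last lia.
  rewrite y0 y1 y2 y3.
  move: (x _) (x _) (x _) (x _) => x0 x1 x2 x3.
  apply/eqP; rewrite eq_complex /=; apply/andP; split; apply/eqP.
    transitivity (x2 * (c * r2 - s * - r1) - x3 * (s * r2 + c * - r1)); first by ring.
    by rewrite E1 E2; ring.
  transitivity (x0 * (c * r2 - s * - r1) - x1 * (s * r2 + c * - r1)); first by ring.
  by rewrite E1 E2; ring.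
- by rewrite rE sqrrN addrC.
Qed.

Lemma lform_reduce n (b : nat -> C) : (0 < n)%N -> exists S (r : R),
  [/\ isometry_on (2 * n) S,
   forall x, lform n b (S x) = Complex (x (2 * n.-1)%N) (x (2 * n.-1 + 1)%N) * Complex r 0 &
   r ^+ 2 = \sum_(j < n) cabs (b j) ^+ 2].
Proof.
move=> n0.
(* Invariant: the coefficients before [k] have been cleared, the [k]-th is real and carries their
   whole square sum together with its own, and the later ones are untouched. *)
suff H k : (k < n)%N -> exists S (r : R), [/\ isometry_on (2 * n) S,
   forall x, lform n b (S x) =
     lform n (fun i => if (i < k)%N then 0 else if i == k then Complex r 0 else b i) x &
   r ^+ 2 = \sum_(j < k.+1) cabs (b j) ^+ 2].
  have [|S [r [iS SE rE]]] := H n.-1; first by lia.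
  exists S, r; split => //; last by rewrite rE prednK.
  move=> x; rewrite SE; case: n n0 {H iS SE rE} => // n _.
  rewrite /lform big_ord_recr/= big1 ?add0r ?ltnn ?eqxx; first by rewrite /= oppr0.
  by move=> i _; rewrite ltn_ord /= oppr0 mulr0.
elim: k => [_|k IH kn].
  have [S [r [iS SE rE]]] := lform_phase b n0.
  exists S, r; split => //; last by rewrite big_ord1.
have [|S [r [iS SE rE]]] := IH; first by lia.
set b' := (fun i => _) in SE.
have [S2 [r2 [iS2 SE2 rE2]]] := lform_phase b' kn.
have [||S3 [r3 [iS3 SE3 rE3]]] := @lform_givens n k (upd b' k.+1 (Complex r2 0)) r r2 kn.
- by rewrite upd_other; [rewrite /b' ltnn eqxx|lia].
- by rewrite upd_same.
exists (S \o S2 \o S3), r3; split.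
- by do 2 apply: isometry_on_comp => //.
- move=> x; rewrite /= SE SE2 SE3; congr lform; apply/funext => i; rewrite /upd /b'.
  have [->|i1] := eqVneq i k.+1; first by rewrite ltnn.
  have [->|i2] := eqVneq i k; first by rewrite ltnSn.
  case: ltnP => ik.
    by rewrite ifT//; lia.
  by rewrite ifF//; lia.
- rewrite rE3 rE rE2 [RHS]big_ord_recr/=; congr (_ + _ ^+ 2); rewrite /b' ifF; last lia.
  by rewrite ifF//; lia.
Qed.

End isometries.

(** * One-dimensional estimates *)

Section power_integrals.
Context {R : realType}.
Local Notation mu := (@lebesgue_measure R).
Implicit Types (x y a b c : R).

Lemma le_powR_npos x y b : 0 < x -> x <= y -> b <= 0 -> y `^ b <= x `^ b.
Proof.
move=> x0 xy b0; have y0 := lt_le_trans x0 xy.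
rewrite -[b]opprK !(powRN _ (- b)) lef_pV2 ?posrE ?powR_gt0//.
by apply: ge0_ler_powR; rewrite ?nnegrE ?oppr_ge0// ltW.
Qed.

Lemma gt0_powRD x b c : 0 < x -> x `^ (b + c) = x `^ b * x `^ c.
Proof. by move=> x0; rewrite powRD// (lt0r_neq0 x0) implybT. Qed.

(** Dominates both 2^b and 2^(-b), so that one comparison constant serves exponents of either
    sign. *)
Definition two_sided b : R := 2 `^ b + 2 `^ (- b).

Lemma two_sided_gt0 b : 0 < two_sided b.
Proof. by rewrite addr_gt0 ?powR_gt0. Qed.

Lemma powR_comparable x y b : 0 < x -> x / 2 <= y -> y <= 2 * x ->
  y `^ b <= two_sided b * x `^ b.
Proof.
move=> x0 xy yx; have y0 : 0 < y by lra.
have [b0|b0] := leP 0 b.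
  apply: (@le_trans _ _ (2 `^ b * x `^ b)); last first.
    by rewrite ler_wpM2r ?powR_ge0// lerDl powR_ge0.
  by rewrite -powRM ?(ltW x0)//; apply: ge0_ler_powR; rewrite ?nnegrE//; lra.
apply: (@le_trans _ _ (2 `^ (- b) * x `^ b)); last first.
  by rewrite ler_wpM2r ?powR_ge0// lerDr powR_ge0.
have x20 : 0 < x / 2 by rewrite divr_gt0.
apply: le_trans (le_powR_npos x20 xy (ltW b0)) _.
rewrite powRN ler_pdivlMl ?powR_gt0// -powRM ?(ltW x20)//.
by rewrite mulrC divfK.
Qed.

(* Zero for [x <= 0], unlike [powR] (0 `^ 0 = 1), so that [posp (1 - |z|^2) alpha] is the
   weight already multiplied by the indicator of the ball. *)
Definition posp (x b : R) : R := if 0 < x then x `^ b else 0.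

Lemma posp_ge0 x b : 0 <= posp x b.
Proof. by rewrite /posp; case: ifP => // _; exact: powR_ge0. Qed.

Lemma posp_gt0E x b : 0 < x -> posp x b = x `^ b.
Proof. by rewrite /posp => ->. Qed.

Lemma posp_le0E x b : x <= 0 -> posp x b = 0.
Proof. by rewrite /posp ltNge => ->. Qed.

Lemma posp0E x : 0 < x -> posp x 0 = 1.
Proof. by move=> x0; rewrite posp_gt0E// powRr0. Qed.

Lemma measurable_posp d (T : measurableType d) (f : T -> R) b :
  measurable_fun setT f -> measurable_fun setT (fun t => posp (f t) b).
Proof.
move=> mf; rewrite /posp; apply: measurable_fun_ifT => //.
  exact: measurable_fun_ltr.
by apply: (measurableT_comp (measurable_powR b)).
Qed.

Lemma measurable_powRl d (T : measurableType d) (f : T -> R) b :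
  measurable_fun setT f -> measurable_fun setT (fun t => f t `^ b).
Proof. by move=> mf; apply: (measurableT_comp (measurable_powR b)). Qed.

Lemma integral_powR_segment a b c : 0 < a -> a < b -> c + 1 != 0 ->
  (\int[mu]_(t in `[a, b]) (t `^ c)%:E = ((b `^ (c + 1) - a `^ (c + 1)) / (c + 1))%:E)%E.
Proof.
move=> a0 ab c1.
pose F t := t `^ (c + 1) / (c + 1).
have dF (t : R) : 0 < t -> is_derive t 1 F (t `^ c).
  move=> t0; have := @is_derive1_powR R (c + 1) t t0 => H.
  have -> : t `^ c = (c + 1)^-1 *: ((c + 1) * t `^ (c + 1 - 1)).
    by rewrite addrK /GRing.scale/= mulKf.
  have -> : F = (c + 1)^-1 *: ((fun t : R => t `^ (c + 1)) : R -> R^o).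
    by apply/funext => u; rewrite /F mulrC.
  exact: is_deriveZ.
have cF (t : R) : 0 < t -> {for t, continuous F}.
  by move=> t0; apply: differentiable_continuous; apply/derivable1_diffP; have [] := dF _ t0.
have cp (t : R) : 0 < t -> {for t, continuous (fun t : R => t `^ c)}.
  move=> t0; apply: differentiable_continuous; apply/derivable1_diffP.
  by have [] := @is_derive1_powR R c t t0.
rewrite (@continuous_FTC2 R _ F)//.
- by rewrite /F -EFinB; congr EFin; rewrite mulrBl.
- apply/continuous_in_subspaceT => t; rewrite inE/= in_itv/= => /andP[at_ _].
  by apply: cp; exact: lt_le_trans at_.
- split.
  + by move=> t; rewrite in_itv/= => /andP[at_ _]; have [] := dF _ (lt_trans a0 at_).
  + by apply: cvg_at_right_filter; exact: cF.
  + by apply: cvg_at_left_filter; apply: cF; exact: lt_trans ab.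
- move=> t; rewrite in_itv/= => /andP[at_ _].
  by rewrite derive1E; have [_ ->] := dF _ (lt_trans a0 at_).
Qed.

Lemma integral_bigcup_le (F : (set R)^nat) (f : R -> \bar R) (M : \bar R) :
  nondecreasing_seq F -> (forall i, measurable (F i)) -> measurable_fun setT f ->
  (forall t, (0 <= f t)%E) -> (forall i, (\int[mu]_(t in F i) f t <= M)%E) ->
  (\int[mu]_(t in \bigcup_i F i) f t <= M)%E.
Proof.
move=> nF mF mf f0 fM.
have mfi i : measurable_fun (F i) f by apply: measurable_funS mf.
have H := @ge0_nondecreasing_set_cvg_integral _ (measurableTypeR R) R F f mu nF mF mfi (fun i x _ => f0 x).
rewrite -(cvg_lim _ H)//; apply: lime_le; first by apply/cvg_ex; eexists; exact: H.
by apply: nearW => i; exact: fM.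
Qed.

(** [posp _ 0] is the indicator of the positive half-line, so the integrand is t^c cut off to the
    open interval from 0 to b. The interval is exhausted by closed segments that avoid the
    singularity, where the fundamental theorem of calculus applies. *)
Lemma integral_powR_near0 b c : 0 < b -> -1 < c ->
  (\int[mu]_t (posp t c * posp (b - t) 0)%:E <= (b `^ (c + 1) / (c + 1))%:E)%E.
Proof.
move=> b0 c1.
(* Starting the denominators at 2 keeps the left end strictly below [b], as [integral_powR_segment]
   demands. *)
pose F n := `[b / n.+2%:R, b]%classic.
have nF : nondecreasing_seq F.
  apply/nondecreasing_seqP => n; rewrite subsetEset => t; rewrite /F /= !in_itv/= => /andP[h ->].
  rewrite andbT; apply: le_trans h; rewrite ler_pM2l// lef_pV2 ?posrE//.
  by rewrite ler_nat.
have mF i : measurable (F i) by exact: measurable_itv.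
have mf : measurable_fun setT (fun t : R => (t `^ c)%:E).
  by apply/measurable_EFinP; exact: measurable_powR.
apply: (@le_trans _ _ (\int[mu]_(t in \bigcup_i F i) (t `^ c)%:E)%E); last first.
  apply: integral_bigcup_le => // [t|i]; first by rewrite lee_fin powR_ge0.
  rewrite /F integral_powR_segment; last 3 first.
  - by rewrite divr_gt0.
  - by rewrite ltr_pdivrMr// ltr_pMr// ltr1n.
  - by apply: lt0r_neq0; lra.
  rewrite lee_fin ler_pM2r ?invr_gt0; last lra.
  by rewrite gerBl powR_ge0.
rewrite [leRHS]integral_mkcond; apply: le_integral_ge0 => t.
  by rewrite lee_fin mulr_ge0 ?posp_ge0.
rewrite patchE /posp.
case: ifPn => [t0|]; last first.
  by rewrite mul0r; case: ifP => // _; rewrite lee_fin powR_ge0.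
case: ifPn => [tb|]; last first.
  by rewrite mulr0; case: ifP => // _; rewrite lee_fin powR_ge0.
rewrite ifT; first by rewrite powRr0 mulr1.
rewrite inE; exists (Num.truncn (b / t)) => //; rewrite /F /= in_itv/=; apply/andP; split; last lra.
rewrite ler_pdivrMr// mulrC -ler_pdivrMr//; apply: ltW.
apply: lt_trans (truncnS_gt _) _.
by rewrite ltr_nat.
Qed.

Lemma integral_powR_tail a c : 0 < a -> c < -1 ->
  (\int[mu]_t (posp (t - a) 0 * t `^ c)%:E <= (a `^ (c + 1) / (- (c + 1)))%:E)%E.
Proof.
move=> a0 c1.
pose F n := `[a, a + n.+1%:R]%classic.
have nF : nondecreasing_seq F.
  apply/nondecreasing_seqP => n; rewrite subsetEset => t; rewrite /F /= !in_itv/= => /andP[-> h] /=.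
  by apply: le_trans h _; rewrite lerD2l ler_nat.
have mF i : measurable (F i) by exact: measurable_itv.
have mf : measurable_fun setT (fun t : R => (t `^ c)%:E).
  by apply/measurable_EFinP; exact: measurable_powR.
apply: (@le_trans _ _ (\int[mu]_(t in \bigcup_i F i) (t `^ c)%:E)%E); last first.
  apply: integral_bigcup_le => // [t|i]; first by rewrite lee_fin powR_ge0.
  rewrite /F integral_powR_segment//; last 2 first.
  - by rewrite ltrDl.
  - by apply: ltr0_neq0; lra.
  rewrite lee_fin invrN mulrN -mulNr ler_nM2r ?invr_lt0; last lra.
  by rewrite lerBrDr addNr powR_ge0.
rewrite [leRHS]integral_mkcond; apply: le_integral_ge0 => t.
  by rewrite lee_fin mulr_ge0 ?posp_ge0 ?powR_ge0.
rewrite patchE /posp.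
case: ifPn => [t0|]; last first.
  by rewrite mul0r; case: ifP => // _; rewrite lee_fin powR_ge0.
rewrite ifT; first by rewrite powRr0 mul1r.
rewrite inE; exists (Num.truncn t) => //; rewrite /F /= in_itv/=; apply/andP; split; first lra.
by have := truncnS_gt t; lra.
Qed.

End power_integrals.

(** * Majorants for weighted integrals on intervals and on the line *)

Section disc_integrals.
Context {R : realType}.
Local Notation mu := (@lebesgue_measure R).

(** Packing measurability and nonnegativity with the bound gives a notion closed under sums,
    scalings, translations and reflections, so majorants can be assembled piece by piece. *)
Record integral_bounded (f : R -> R) (a : R) : Prop := IntegralBounded {
  ib_measurable : measurable_fun setT f;
  ib_ge0 : forall t, 0 <= f t;
  ib_le : (\int[mu]_t (f t)%:E <= a%:E)%E }.

Lemma integral_boundedD (f g : R -> R) a b : integral_bounded f a -> integral_bounded g b ->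
  integral_bounded (fun t => f t + g t) (a + b).
Proof.
move=> [mf f0 fa] [mg g0 gb]; split.
- exact: measurable_funD.
- by move=> t; rewrite addr_ge0.
- under eq_integral do rewrite EFinD.
  rewrite ge0_integralD//=; last 4 first.
  + by move=> t _; rewrite lee_fin.
  + exact/measurable_EFinP.
  + by move=> t _; rewrite lee_fin.
  + exact/measurable_EFinP.
  by rewrite EFinD leeD.
Qed.

Lemma integral_boundedZ c f a : 0 <= c -> integral_bounded f a ->
  integral_bounded (fun t => c * f t) (c * a).
Proof.
move=> c0 [mf f0 fa]; split.
- exact: measurable_funM.
- by move=> t; rewrite mulr_ge0.
- under eq_integral do rewrite EFinM.
  rewrite ge0_integralZl//=; last 2 first.
  + exact/measurable_EFinP.
  + by move=> t _; rewrite lee_fin.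
  by rewrite EFinM lee_pmul// integral_ge0// => t _; rewrite lee_fin.
Qed.

Lemma integral_bounded_shift c f a : integral_bounded f a ->
  integral_bounded (fun t => f (c + t)) a.
Proof.
move=> [mf f0 fa].
split=> //; first by apply: (measurableT_comp mf); exact: measurable_funD.
under eq_integral do rewrite addrC.
rewrite (lebesgue_integral_shift (f := fun t => (f t)%:E))//.
exact/measurable_EFinP.
Qed.

Lemma integral_bounded_reflect c f a : integral_bounded f a ->
  integral_bounded (fun t => f (c - t)) a.
Proof.
move=> /(integral_bounded_shift c) [mf f0 fa].
split=> //; first by apply: (measurableT_comp mf).
rewrite (lebesgue_integral_opp (f := fun t => (f (c + t))%:E))//.
exact/measurable_EFinP.
Qed.

Lemma le_integral_bounded (f g : R -> R) a : measurable_fun setT f -> (forall t, 0 <= f t) ->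
  (forall t, f t <= g t) -> integral_bounded g a -> integral_bounded f a.
Proof.
move=> mf f0 fg [mg g0 ga]; split=> //; apply: le_trans ga.
by apply: le_integral_ge0 => t; rewrite lee_fin.
Qed.

Lemma integral_bounded_near0 b c : 0 < b -> -1 < c ->
  integral_bounded (fun t => posp t c * posp (b - t) 0) (b `^ (c + 1) / (c + 1)).
Proof.
move=> b0 c1; split; last exact: integral_powR_near0.
- by apply: measurable_funM; apply: measurable_posp => //; exact: measurable_funB.
- by move=> t; rewrite mulr_ge0 ?posp_ge0.
Qed.

Lemma integral_bounded_tail b c : 0 < b -> c < -1 ->
  integral_bounded (fun t => posp (t - b) 0 * t `^ c) (b `^ (c + 1) / (- (c + 1))).
Proof.
move=> b0 c1; split; last exact: integral_powR_tail.
- apply: measurable_funM; last exact: measurable_powR.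
  by apply: measurable_posp; exact: measurable_funB.
- by move=> t; rewrite mulr_ge0 ?posp_ge0 ?powR_ge0.
Qed.

Lemma measurable_posp_sub (T c : R) b : measurable_fun setT (fun t : R => posp (T - t ^+ 2) b).
Proof. by apply: measurable_posp; apply: measurable_funB => //; exact: exprn_measurable. Qed.

(** With S^2 = T the integrand is (S + t)^b (S - t)^b. On each half of the interval one factor is
    comparable to S^b, which leaves a power singularity at a single endpoint. *)
Lemma integral_posp_sub_sqr b : -1 < b -> exists2 c, 0 < c &
  forall T : R, 0 < T -> integral_bounded (fun t => posp (T - t ^+ 2) b) (c * T `^ (b + 2^-1)).
Proof.
move=> b1; pose c := two_sided b * (2 * (2 `^ (b + 1) / (b + 1))).
have c0 : 0 < c by rewrite !mulr_gt0 ?two_sided_gt0 ?powR_gt0// invr_gt0; lra.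
exists c => // T T0; pose S := Num.sqrt T.
have S0 : 0 < S by rewrite sqrtr_gt0.
have SE : S ^+ 2 = T by rewrite sqr_sqrtr// ltW.
have S20 : 0 < 2 * S by rewrite mulr_gt0.
have hb := integral_bounded_near0 S20 b1.
set h := fun t => _ in hb.
have hb2 := integral_boundedD (integral_bounded_shift S hb) (integral_bounded_reflect S hb).
have cc : 0 <= two_sided b * S `^ b by rewrite mulr_ge0 ?powR_ge0// ltW ?two_sided_gt0.
have := integral_boundedZ cc hb2.
have -> : two_sided b * S `^ b * ((2 * S) `^ (b + 1) / (b + 1) + (2 * S) `^ (b + 1) / (b + 1)) =
    c * T `^ (b + 2^-1).
  have -> : T `^ (b + 2^-1) = S `^ b * S `^ (b + 1).
    rewrite -SE -(@powR_mulrn _ S 2 (ltW S0)) -powRrM -gt0_powRD//.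
    by congr (_ `^ _); by field.
  by rewrite powRM ?(ltW S0)// /c; field; lra.
apply: le_integral_bounded => [|t|t]; [exact: measurable_posp_sub|exact: posp_ge0|].
have h0 u : 0 <= h u by rewrite /h mulr_ge0 ?posp_ge0.
have [tT|tT] := leP T (t ^+ 2).
  by rewrite posp_le0E ?subr_le0// mulr_ge0// addr_ge0.
have [t1 t2] : - S < t /\ t < S by split; nra.
have E : T - t ^+ 2 = (S + t) * (S - t) by rewrite -SE; ring.
have St1 : 0 < S + t by lra.
have St2 : 0 < S - t by lra.
rewrite posp_gt0E ?subr_gt0// E powRM ?(ltW St1) ?(ltW St2)//.
have hE u : 0 < u -> u < 2 * S -> h u = u `^ b.
  by move=> u0 u1; rewrite /h posp0E ?subr_gt0// mulr1 posp_gt0E.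
rewrite (hE (S + t)) ?(hE (S - t)); try lra.
rewrite -mulrA mulrDr mulrDr.
have K0 : 0 <= two_sided b by rewrite ltW ?two_sided_gt0.
have [t0|t0] := leP 0 t.
  apply: (@le_trans _ _ (two_sided b * (S `^ b * (S - t) `^ b))); last first.
    by rewrite lerDr !mulr_ge0 ?powR_ge0.
  by rewrite mulrA ler_wpM2r ?powR_ge0// powR_comparable//; lra.
apply: (@le_trans _ _ (two_sided b * (S `^ b * (S + t) `^ b))); last first.
  by rewrite lerDl !mulr_ge0 ?powR_ge0.
by rewrite mulrA mulrC ler_wpM2r ?powR_ge0// powR_comparable//; lra.
Qed.

(** The integrand is at most A^(-s) for |y| < A and at most |y|^(-s) beyond; both pieces integrate
    to a multiple of A^(1 - s). *)
Lemma integral_inv_powR_sqr s : 1 < s -> exists2 c, 0 < c &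
  forall A : R, 0 < A -> integral_bounded (fun y => (A ^+ 2 + y ^+ 2) `^ (- (s / 2))) (c * A `^ (1 - s)).
Proof.
move=> s1.
have s1' : -1 < (0 : R) by lra.
have s2 : - s < -1 by lra.
pose c := 2 + 2 * (2^-1 `^ (1 - s) / (s - 1)).
have c0 : 0 < c by rewrite addr_gt0// !mulr_gt0 ?powR_gt0 ?invr_gt0//; lra.
exists c => // A A0.
have A20 : 0 < 2 * A by lra.
(* The tails start at A / 2 because the cutoff of [integral_bounded_tail] vanishes at its own
   threshold, while |y| = A has to be covered. *)
have Ah : 0 < 2^-1 * A by lra.
have hk := integral_bounded_tail Ah s2.
set k := fun t => _ in hk.
have hh := integral_bounded_shift A (integral_bounded_near0 A20 s1').
have AA : 0 <= A `^ (- s) by rewrite powR_ge0.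
have := integral_boundedD (integral_boundedZ AA hh)
  (integral_boundedD (integral_bounded_shift 0 hk) (integral_bounded_reflect 0 hk)).
set rhs := (X in integral_bounded _ X -> _).
have -> : rhs = c * A `^ (1 - s).
  rewrite /rhs add0r powRr1 ?(ltW A20)// divr1 powRM ?(ltW A0) ?invr_ge0//.
  rewrite (_ : - s + 1 = 1 - s); last by ring.
  by rewrite (gt0_powRD 1 (- s) A0) powRr1 ?(ltW A0)// /c; field; lra.
have Q0 y : 0 < A ^+ 2 + y ^+ 2 by rewrite ltr_wpDr ?sqr_ge0// exprn_gt0.
apply: le_integral_bounded => [|y|y]; [| exact: powR_ge0 |].
  apply: measurable_powRl; apply: measurable_funD => //; exact: exprn_measurable.
have k0 u : 0 <= k u by rewrite /k mulr_ge0 ?posp_ge0 ?powR_ge0.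
have sq (u : R) : 0 <= u -> u `^ (- s) = (u ^+ 2) `^ (- (s / 2)).
  move=> u0; rewrite -(@powR_mulrn _ u 2 u0) -powRrM; congr (_ `^ _); by field.
have s0 : - (s / 2) <= 0 by lra.
have [yA|Ay] := ltP (`|y|) A.
  move: yA; rewrite ltr_norml => /andP[y1 y2].
  apply: (@le_trans _ _ (A `^ (- s))); last first.
    rewrite posp0E ?posp0E; try lra.
    by rewrite !mulr1 lerDl addr_ge0.
  by rewrite (sq _ (ltW A0)); apply: le_powR_npos; rewrite ?exprn_gt0 ?lerDl ?sqr_ge0.
have kE : `|y| `^ (- s) <= k (0 + y) + k (0 - y).
  have kA : k `|y| = `|y| `^ (- s) by rewrite /k posp0E ?mul1r//; lra.
  rewrite -kA add0r sub0r; case: (leP 0 y) => y0.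
    by rewrite ger0_norm// lerDl.
  by rewrite ltr0_norm// lerDr.
apply: (@le_trans _ _ (k (0 + y) + k (0 - y))); last first.
  by rewrite lerDr !mulr_ge0 ?posp_ge0.
apply: le_trans kE; rewrite sq// real_normK ?num_real//.
apply: le_powR_npos; rewrite ?lerDr ?sqr_ge0//.
by rewrite -real_normK ?num_real// exprn_gt0//; lra.
Qed.

(** Split at y^2 = T / 2. Below, the first factor is comparable to T^b and the second one is
    integrated. Above, a factor (A^2 + y^2)^(-1/2) is bounded by (T / 2)^(-1/2), which cancels the
    gain T^(1/2) from integrating the first factor, and the rest is at most A^(1 - s). *)
Lemma integral_posp_sub_sqr_weighted b s : -1 < b -> 1 < s -> exists2 c, 0 < c &
  forall T A : R, 0 < T -> 0 < A ->
  integral_bounded (fun y => posp (T - y ^+ 2) b * (A ^+ 2 + y ^+ 2) `^ (- (s / 2)))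
    (c * (T `^ b * A `^ (1 - s))).
Proof.
move=> b1 s1.
have [c1 c10 H1] := integral_posp_sub_sqr b1.
have [c2 c20 H2] := integral_inv_powR_sqr s1.
pose c := two_sided b * c2 + 2^-1 `^ (- 2^-1) * c1.
have c0 : 0 < c by rewrite addr_gt0// mulr_gt0 ?two_sided_gt0 ?powR_gt0.
exists c => // T A T0 A0.
have Th : 0 < T / 2 by lra.
have z1 : 0 <= two_sided b * T `^ b by rewrite mulr_ge0 ?powR_ge0 ?ltW ?two_sided_gt0.
have z2 : 0 <= (T / 2) `^ (- 2^-1) * A `^ (1 - s) by rewrite mulr_ge0 ?powR_ge0.
have := integral_boundedD (integral_boundedZ z1 (H2 A A0)) (integral_boundedZ z2 (H1 T T0)).
have -> : two_sided b * T `^ b * (c2 * A `^ (1 - s)) +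
  (T / 2) `^ (- 2^-1) * A `^ (1 - s) * (c1 * T `^ (b + 2^-1)) = c * (T `^ b * A `^ (1 - s)).
  rewrite powRM ?(ltW T0) ?invr_ge0// (gt0_powRD b 2^-1 T0).
  have E : T `^ (- 2^-1) * T `^ 2^-1 = 1.
    by rewrite -gt0_powRD// addNr powRr0.
  rewrite /c [RHS]mulrDl; congr (_ + _); first by ring.
  transitivity (2^-1 `^ (- 2^-1) * c1 * (T `^ b * A `^ (1 - s)) * (T `^ (- 2^-1) * T `^ 2^-1)).
    by ring.
  by rewrite E mulr1.
have Q0 y : 0 < A ^+ 2 + y ^+ 2 by rewrite ltr_wpDr ?sqr_ge0// exprn_gt0.
apply: le_integral_bounded => [|y|y]; [| by rewrite mulr_ge0 ?posp_ge0 ?powR_ge0 |].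
  apply: measurable_funM; first exact: measurable_posp_sub.
  apply: measurable_powRl; apply: measurable_funD => //; exact: exprn_measurable.
have [yT|yT] := leP (y ^+ 2) (T / 2).
  apply: (@le_trans _ _ (two_sided b * T `^ b * (A ^+ 2 + y ^+ 2) `^ (- (s / 2)))); last first.
    by rewrite lerDl mulr_ge0// posp_ge0.
  rewrite ler_wpM2r ?powR_ge0//; rewrite posp_gt0E; last lra.
  by apply: powR_comparable => //; have := sqr_ge0 y; lra.
apply: (@le_trans _ _ ((T / 2) `^ (- 2^-1) * A `^ (1 - s) * posp (T - y ^+ 2) b)); last first.
  by rewrite lerDr mulr_ge0// powR_ge0.
rewrite mulrC ler_wpM2r ?posp_ge0//.
rewrite (_ : - (s / 2) = - 2^-1 + (1 - s) / 2); last by field.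
rewrite (gt0_powRD (- 2^-1) ((1 - s) / 2) (Q0 y)).
rewrite ler_pM ?powR_ge0//.
  by apply: le_powR_npos => //; have := sqr_ge0 A; lra.
have -> : A `^ (1 - s) = (A ^+ 2) `^ ((1 - s) / 2).
  rewrite -(@powR_mulrn _ A 2 (ltW A0)) -powRrM; congr (_ `^ _); by field.
by apply: le_powR_npos; rewrite ?exprn_gt0 ?lerDl ?sqr_ge0//; lra.
Qed.

(** Put u = 1 - |x| and d = 1 - |r|. Then 1 - x^2 is comparable to u, and 1 - r x is at least both u
    and d. For u < d the majorant is d^(-(b+1+m)) u^b, for u >= d it is u^(-1-m), and each
    integrates to a multiple of d^(-m). The cutoffs 2 d and d / 2 in the code let the two ranges
    overlap. *)
Lemma integral_posp_one_sub_sqr b m : -1 < b -> 0 < m -> exists2 c, 0 < c &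
  forall r : R, `|r| < 1 ->
  integral_bounded (fun x => posp (1 - x ^+ 2) b * (1 - r * x) `^ (- (b + 1 + m)))
    (c * (1 - `|r|) `^ (- m)).
Proof.
move=> b1 m0.
pose c := two_sided b * (2 * (2 `^ (b + 1) / (b + 1) + 2^-1 `^ (- m) / m)).
have c0 : 0 < c.
  by rewrite !mulr_gt0 ?two_sided_gt0// addr_gt0// mulr_gt0 ?powR_gt0 ?invr_gt0//; lra.
exists c => // r r1; set d := 1 - `|r|.
have d0 : 0 < d by rewrite subr_gt0.
have d20 : 0 < 2 * d by lra.
have dh : 0 < 2^-1 * d by lra.
have m1 : - 1 - m < -1 by lra.
have z : 0 <= d `^ (- (b + 1 + m)) by rewrite powR_ge0.
have hp := integral_boundedD (integral_boundedZ z (integral_bounded_near0 d20 b1))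
  (integral_bounded_tail dh m1).
set p := (fun t => _ + _) in hp.
have K0 : 0 <= two_sided b by rewrite ltW ?two_sided_gt0.
have := integral_boundedZ K0 (integral_boundedD (integral_bounded_shift 1 hp) (integral_bounded_reflect 1 hp)).
set rhs := (X in integral_bounded _ X -> _).
have -> : rhs = c * d `^ (- m).
  rewrite /rhs !powRM ?(ltW d0) ?invr_ge0//.
  rewrite (_ : - 1 - m + 1 = - m); last by ring.
  have E : d `^ (- (b + 1 + m)) * d `^ (b + 1) = d `^ (- m).
    rewrite -gt0_powRD//.
    by congr (_ `^ _); ring.
  rewrite /c -E; field; rewrite gt_eqF//; lra.
have p0 u : 0 <= p u by rewrite /p addr_ge0// !mulr_ge0 ?posp_ge0 ?powR_ge0.
apply: le_integral_bounded => [|x|x]; [| by rewrite mulr_ge0 ?posp_ge0 ?powR_ge0 |].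
  apply: measurable_funM; first exact: measurable_posp_sub.
  by apply: measurable_powRl; apply: measurable_funB => //; exact: measurable_funM.
have [x1|x1] := leP 1 (x ^+ 2).
  by rewrite posp_le0E ?subr_le0// mul0r mulr_ge0// addr_ge0.
have xa : `|x| < 1 by rewrite -(@ltr_pXn2r _ 2) ?nnegrE// ?expr1n ?real_normK ?num_real.
pose u := 1 - `|x|.
have u0 : 0 < u by rewrite subr_gt0.
have x0 := normr_ge0 x; have r0 := normr_ge0 r.
have pu : p u <= p (1 + x) + p (1 - x).
  rewrite /u; case: (leP 0 x) => h; first by rewrite ger0_norm// lerDr.
  by rewrite ltr0_norm// opprK lerDl.
apply: le_trans (ler_wpM2l K0 pu).
rewrite posp_gt0E ?subr_gt0//.
have xE : 1 - x ^+ 2 = u * (1 + `|x|) by rewrite -[x ^+ 2]real_normK ?num_real// /u; ring.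
have h1 : (1 - x ^+ 2) `^ b <= two_sided b * u `^ b.
  by rewrite xE; apply: powR_comparable => //; rewrite /u in u0 *; nra.
have rx : r * x <= `|r| * `|x| by rewrite -normrM ler_norm.
have h2 : d <= 1 - r * x by rewrite /d; nra.
have h3 : u <= 1 - r * x by rewrite /u; nra.
apply: (@le_trans _ _ ((two_sided b * u `^ b) * (1 - r * x) `^ (- (b + 1 + m)))).
  by rewrite ler_wpM2r ?powR_ge0.
rewrite -mulrA ler_wpM2l//.
have e0 : - (b + 1 + m) <= 0 by lra.
rewrite /p; have [ud|ud] := ltP u d.
  apply: (@le_trans _ _ (d `^ (- (b + 1 + m)) * (posp u b * posp (2 * d - u) 0))); last first.
    by rewrite lerDl mulr_ge0 ?posp_ge0 ?powR_ge0.
  rewrite posp_gt0E// posp0E ?mulr1; last lra.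
  by rewrite mulrC ler_wpM2r ?powR_ge0// le_powR_npos.
apply: (@le_trans _ _ (posp (u - 2^-1 * d) 0 * u `^ (- 1 - m))); last first.
  by rewrite lerDr mulr_ge0 ?powR_ge0// mulr_ge0 ?posp_ge0.
rewrite posp0E ?mul1r; last lra.
rewrite (_ : - 1 - m = b + - (b + 1 + m)); last by ring.
rewrite (gt0_powRD b (- (b + 1 + m)) u0).
by rewrite ler_wpM2l ?powR_ge0// le_powR_npos.
Qed.

End disc_integrals.

(** * The Forelli-Rudin estimate *)

Section forelli_rudin.
Context {R : realType}.
Local Notation mu := (@lebesgue_measure R).
Local Notation seqR := (nat -> R).
Local Notation C := (complex R).

Definition nsq (w : C) : R := complex.Re w ^+ 2 + complex.Im w ^+ 2.

Lemma cabs_sqr w : cabs w ^+ 2 = nsq w.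
Proof. by case: w => x y; rewrite /= sqr_sqrtr// addr_ge0 ?sqr_ge0. Qed.

Lemma cabs_ge0 (w : C) : 0 <= cabs w.
Proof. by case: w => x y; rewrite /= sqrtr_ge0. Qed.

Lemma cabs_powR w s : cabs w `^ s = nsq w `^ (s / 2).
Proof.
by rewrite -cabs_sqr -powR_mulrn ?cabs_ge0// -powRrM; congr (_ `^ _); field.
Qed.

Definition tailsq (k N : nat) (x : seqR) : R := \sum_(k <= i < N) x i ^+ 2.

Lemma tailsq_upd k N x t : (k < N)%N ->
  tailsq k N (upd x k t) = t ^+ 2 + tailsq k.+1 N x.
Proof.
move=> kN; rewrite /tailsq big_ltn// upd_same; congr (_ + _).
by apply: eq_big_nat => i /andP[ki _]; rewrite upd_other//; lia.
Qed.

Lemma integral_posp_sub_sqrT b : -1 < b -> exists2 c, 0 < c &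
  forall T : R, integral_bounded (fun t => posp (T - t ^+ 2) b) (c * posp T (b + 2^-1)).
Proof.
move=> b1; have [c c0 H] := integral_posp_sub_sqr b1; exists c => // T.
have [T0|T0] := ltP 0 T; first by rewrite posp_gt0E//; exact: H.
rewrite posp_le0E// mulr0; split; first exact: measurable_posp_sub.
  by move=> t; exact: posp_ge0.
rewrite integral0_eq// => t _; rewrite posp_le0E//; have := sqr_ge0 t; lra.
Qed.

(** Each real coordinate that is integrated out raises the exponent of the weight by 1/2. The factor
    [w] does not see these coordinates and comes out of the integrals. *)
Lemma iint_posp_tail (N k : nat) (b : R) : (k <= N)%N -> -1 < b -> exists2 c, 0 < c &
  forall w : seqR -> R, (forall x, 0 <= w x) ->
  (forall l x t, (l < k)%N -> w (upd x l t) = w x) ->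
  forall x, (iint k (fun x => (posp (1 - tailsq 0 N x) b * w x)%:E) x <=
    (c * posp (1 - tailsq k N x) (b + k%:R / 2) * w x)%:E)%E.
Proof.
move=> + b1; elim: k => [|k IH] kN.
  by exists 1 => // w w0 _ x; rewrite /= mul0r addr0 mul1r.
have [c c0 H] := IH (ltnW kN).
have b1' : -1 < b + k%:R / 2.
  by apply: (lt_le_trans b1); rewrite lerDl divr_ge0.
have [d d0 D] := integral_posp_sub_sqrT b1'.
exists (c * d); first exact: mulr_gt0.
move=> w w0 wk x; rewrite iintS.
have cw : 0 <= c * w x by rewrite mulr_ge0// ltW.
have [_ _ E] := integral_boundedZ cw (D (1 - tailsq k.+1 N x)).
have -> : c * d * posp (1 - tailsq k.+1 N x) (b + k.+1%:R / 2) * w x =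
  c * w x * (d * posp (1 - tailsq k.+1 N x) (b + k%:R / 2 + 2^-1)).
  rewrite (_ : b + k.+1%:R / 2 = b + k%:R / 2 + 2^-1); first by ring.
  by rewrite -natr1; field.
apply: le_trans E; apply: le_integral_ge0 => t.
  by apply: iint_ge0 => y; rewrite lee_fin mulr_ge0 ?posp_ge0.
apply: le_trans (H w w0 _ (upd x k t)) _.
  by move=> l y r lk; apply: wk; rewrite ltnS ltnW.
rewrite lee_fin wk// tailsq_upd// opprD addrA [1 - _ - _]addrAC.
by rewrite le_eqVlt; apply/orP; left; apply/eqP; ring.
Qed.

(** Replaces the coefficient r^2 of v^2, which degenerates as r tends to 0, by a constant. If r^2 <
    1/4, then 1 - r u is at least 1/2 while v^2 < 1, so the first square alone suffices. *)
Lemma disc_quadratic_lower (r u v : R) : `|r| < 1 -> u ^+ 2 + v ^+ 2 < 1 ->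
  ((1 - r * u) ^+ 2 + v ^+ 2) / 8 <= (1 - r * u) ^+ 2 + r ^+ 2 * v ^+ 2.
Proof.
move=> r1 uv.
have v0 := sqr_ge0 v; have u0 := sqr_ge0 u; have q0 := sqr_ge0 (1 - r * u).
have [r2|r2] := leP (1 / 4) (r ^+ 2).
  have : 1 / 4 * v ^+ 2 <= r ^+ 2 * v ^+ 2 by rewrite ler_wpM2r.
  lra.
have ru : `|r * u| <= 1 / 2.
  rewrite -(@ler_pXn2r _ 2) ?nnegrE//.
  rewrite real_normK ?num_real// exprMn.
  have : r ^+ 2 * u ^+ 2 <= r ^+ 2 by rewrite ler_piMr ?sqr_ge0//; lra.
  by move: r2; lra.
have h : 1 / 2 <= 1 - r * u by have := ler_norm (r * u); lra.
have : 1 / 4 <= (1 - r * u) ^+ 2 by nra.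
have : 0 <= r ^+ 2 * v ^+ 2 by rewrite mulr_ge0 ?sqr_ge0.
lra.
Qed.

(** After the first [K] coordinates a planar integral with weight exponent e = b + K/2 is left. The
    imaginary part v is integrated before the real part u: then A = 1 - r u is a positive constant,
    and the result (1 - u^2)^e (1 - r u)^(1 - s), where 1 - s = -(e + 1 + m), has exactly the shape
    treated by [integral_posp_one_sub_sqr]. *)
Lemma iint_reduced_kernel (K : nat) (b m : R) : -1 < b -> 0 < m -> exists2 c, 0 < c &
  forall r : R, `|r| < 1 -> forall x,
  (iint K.+2 (fun x => (posp (1 - tailsq 0 K.+2 x) b *
     ((1 - r * x K.+1) ^+ 2 + r ^+ 2 * x K ^+ 2) `^ (- ((b + K%:R / 2 + 2 + m) / 2)))%:E) x
   <= (c * (1 - `|r|) `^ (- m))%:E)%E.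
Proof.
move=> b1 m0.
have K2 : (K < K.+2)%N by rewrite ltnW.
have K3 : K.+1 != K by rewrite gtn_eqF.
have neK l : (l < K)%N -> K != l /\ K.+1 != l by move=> lK; rewrite !gtn_eqF// ltnW.
pose e := b + K%:R / 2; have e1 : -1 < e by apply: (lt_le_trans b1); rewrite lerDl divr_ge0.
rewrite -/e; pose s := e + 2 + m; rewrite -/s.
have s1 : 1 < s by rewrite /s; lra.
have [c1 c10 H1] := @iint_posp_tail K.+2 K b (leqW (leqnSn K)) b1.
have [c2 c20 H2] := integral_posp_sub_sqr_weighted e1 s1.
have [c3 c30 H3] := integral_posp_one_sub_sqr e1 m0.
pose c8 : R := 8^-1 `^ (- (s / 2)).
have c80 : 0 < c8 by rewrite powR_gt0.
exists (c1 * c8 * c2 * c3); first by rewrite !mulr_gt0.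
move=> r r1 x.
pose w (x : seqR) := ((1 - r * x K.+1) ^+ 2 + r ^+ 2 * x K ^+ 2) `^ (- (s / 2)).
have w0 y : 0 <= w y by rewrite powR_ge0.
have wK l y t : (l < K)%N -> w (upd y l t) = w y.
  by move=> /neK[n1 n2]; rewrite /w !upd_other.
rewrite iintS.
have k0 : 0 <= c1 * c8 * c2 by rewrite !mulr_ge0// ltW.
have [_ _ E] := integral_boundedZ k0 (H3 r r1).
rewrite -[leRHS]/((_ * c3 * _)%:E) -[in leRHS]mulrA; apply: le_trans E.
apply: le_integral_ge0 => u.
  by apply: iint_ge0 => y; rewrite lee_fin mulr_ge0 ?posp_ge0 ?powR_ge0.
rewrite iintS.
have [u1|u1] := ltP (u ^+ 2) 1; last first.
  rewrite integral0_eq.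
    by rewrite lee_fin !mulr_ge0 ?posp_ge0 ?powR_ge0// ltW.
  move=> v _; apply/eqP; rewrite eq_le; apply/andP; split; last first.
    by apply: iint_ge0 => y; rewrite lee_fin mulr_ge0 ?posp_ge0 ?powR_ge0.
  apply: le_trans (H1 w w0 wK _) _.
  rewrite (tailsq_upd _ _ K2) (tailsq_upd _ _ (ltnSn K.+1)).
  rewrite /tailsq big_geq// addr0 posp_le0E ?mulr0 ?mul0r//.
  by have := sqr_ge0 v; lra.
have A0 : 0 < 1 - r * u.
  have := ler_norm (r * u); rewrite normrM.
  have ua : `|u| < 1 by rewrite -(@ltr_pXn2r _ 2) ?nnegrE// ?expr1n ?real_normK ?num_real.
  by have := normr_ge0 u; have := normr_ge0 r; nra.
have T0 : 0 < 1 - u ^+ 2 by rewrite subr_gt0.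
have k1 : 0 <= c1 * c8 by rewrite !mulr_ge0// ltW.
have [_ _ E2] := integral_boundedZ k1 (H2 _ _ T0 A0).
rewrite posp_gt0E//.
rewrite (_ : - (e + 1 + m) = 1 - s); last by rewrite /s; ring.
rewrite -[c1 * c8 * c2 * _]mulrA; apply: le_trans E2.
apply: le_integral_ge0 => v.
  by apply: iint_ge0 => y; rewrite lee_fin mulr_ge0 ?posp_ge0 ?powR_ge0.
apply: le_trans (H1 w w0 wK _) _.
rewrite (tailsq_upd _ _ K2) (tailsq_upd _ _ (ltnSn K.+1)).
rewrite /tailsq big_geq// addr0 -/e lee_fin.
rewrite /w upd_same (upd_other _ _ K3) upd_same opprD addrA addrAC.
have [uv|uv] := ltP (u ^+ 2 + v ^+ 2) 1; last first.
  by rewrite posp_le0E ?mulr0 ?mul0r//; lra.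
rewrite -[leLHS]mulrA -[leRHS]mulrA ler_wpM2l ?(ltW c10)//.
rewrite [leRHS]mulrCA ler_wpM2l ?posp_ge0//.
have Q0 : 0 < (1 - r * u) ^+ 2 + v ^+ 2 by rewrite ltr_wpDr ?sqr_ge0// exprn_gt0.
rewrite /c8 -powRM ?invr_ge0// ?(ltW Q0)//.
apply: le_powR_npos; first by rewrite mulr_gt0.
  by rewrite mulrC; exact: disc_quadratic_lower.
lra.
Qed.

Lemma cmeasurable_lform n (b : nat -> C) :
  cmeasurable (fun x : seqR => complex.Re (lform n b x)) /\
  cmeasurable (fun x : seqR => complex.Im (lform n b x)).
Proof.
elim: n => [|n [IH1 IH2]].
  split=> d T phi mphi; rewrite /lform.
    by under eq_fun do rewrite big_ord0; exact: measurable_cst.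
  by under eq_fun do rewrite big_ord0; exact: measurable_cst.
have E x : lform n.+1 b x = lform n b x + Complex (x (2 * n)%N) (x (2 * n + 1)%N) * cconj (b n).
  by rewrite /lform big_ord_recr.
case: (b n) E => p q E; split=> d T phi mphi.
  have -> : (fun t => complex.Re (lform n.+1 b (phi t))) = fun t =>
      complex.Re (lform n b (phi t)) + (phi t (2 * n)%N * p - phi t (2 * n + 1)%N * - q).
    by apply/funext => t; rewrite E; case: (lform n b (phi t)).
  apply: measurable_funD; first exact: IH1.
  by apply: measurable_funB; apply: measurable_funM.
have -> : (fun t => complex.Im (lform n.+1 b (phi t))) = fun t =>
    complex.Im (lform n b (phi t)) + (phi t (2 * n)%N * - q + phi t (2 * n + 1)%N * p).
  by apply/funext => t; rewrite E; case: (lform n b (phi t)).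
apply: measurable_funD; first exact: IH2.
by apply: measurable_funD; apply: measurable_funM.
Qed.

Lemma cmeasurable_sumsq N : cmeasurable (@sumsq R N).
Proof.
move=> d T phi mphi; rewrite /sumsq; apply: measurable_sum => i.
exact: measurable_funX.
Qed.

Definition kernel_integrand n (al s : R) (a : 'rV[C]_n) (x : seqR) : R :=
  posp (1 - sumsq (2 * n) x) al * nsq (1 - hdot (cvec_of n x) a) `^ (- (s / 2)).

Lemma hdot_lform n (a : 'rV[C]_n.+1) (x : seqR) :
  hdot (cvec_of n.+1 x) a = lform n.+1 (fun j => a ord0 (inord j)) x.
Proof. by apply: eq_bigr => j _; rewrite mxE inord_val. Qed.

Lemma kernel_integrand_ge0 n al s (a : 'rV[C]_n) x : 0 <= kernel_integrand al s a x.
Proof. by rewrite mulr_ge0 ?posp_ge0 ?powR_ge0. Qed.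

Lemma nsq_1B (w : C) : nsq (1 - w) = (1 - complex.Re w) ^+ 2 + complex.Im w ^+ 2.
Proof. by case: w => x y; rewrite /nsq /= sub0r sqrrN. Qed.

Lemma cmeasurable_kernel_integrand n al s (a : 'rV[C]_n.+1) :
  cmeasurable (fun x => (kernel_integrand al s a x)%:E).
Proof.
move=> d T phi mphi; apply/measurable_EFinP; apply: measurable_funM.
  by apply: measurable_posp; apply: measurable_funB => //; exact: cmeasurable_sumsq.
apply: measurable_powRl.
under eq_fun do rewrite hdot_lform nsq_1B.
have [m1 m2] := @cmeasurable_lform n.+1 (fun j => a ord0 (inord j)).
apply: measurable_funD; apply: measurable_funX; last exact: m2.
by apply: measurable_funB => //; exact: m1.
Qed.

Lemma forelli_rudin n (al m : R) : -1 < al -> 0 < m -> exists2 c, 0 < c &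
  forall (a : 'rV[C]_n.+1), vnorm2 a < 1 ->
  (iint (2 * n.+1) (fun x => (kernel_integrand al (n.+1%:R + 1 + al + m) a x)%:E) (fun=> 0%R)
    <= (c * (1 - vnorm2 a) `^ (- m))%:E)%E.
Proof.
move=> al1 m0; pose K := (2 * n)%N.
have NK : (2 * n.+1 = K.+2)%N by rewrite /K mulnS.
have [c c0 H] := @iint_reduced_kernel K al m al1 m0.
have c20 : 0 < c * 2^-1 `^ (- m) by rewrite mulr_gt0// powR_gt0.
exists (c * 2^-1 `^ (- m)) => // a a1.
have [//|S [r [iS SE rE]]] := @lform_reduce R n.+1 (fun j => a ord0 (inord j)).
have rE' : r ^+ 2 = vnorm2 a by rewrite rE; apply: eq_bigr => j _; rewrite inord_val.
have r1 : `|r| < 1.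
  by rewrite -(@ltr_pXn2r _ 2) ?nnegrE// ?expr1n real_normK ?num_real// rE'.
(* The extra swap places the real part of the last complex coordinate outermost, the order expected
   by [iint_reduced_kernel]. *)
have [[mS pS] qS] : isometry_on (2 * n.+1) (S \o swap_adj K).
  by apply: isometry_on_comp => //; apply: isometry_on_swap; lia.
rewrite -pS; last 2 first.
- exact: cmeasurable_kernel_integrand.
- by move=> x; rewrite lee_fin kernel_integrand_ge0.
apply: (@le_trans _ _ (c * (1 - `|r|) `^ (- m))%:E).
  have E : (fun x => (kernel_integrand al (n.+1%:R + 1 + al + m) a x)%:E) \o (S \o swap_adj K) =
      fun x => (posp (1 - tailsq 0 K.+2 x) al * ((1 - r * x K.+1) ^+ 2 + r ^+ 2 * x K ^+ 2)
        `^ (- ((al + K%:R / 2 + 2 + m) / 2)))%:E.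
    apply/funext => x; congr (_%:E).
    have := qS x; rewrite /kernel_integrand /= => ->; rewrite hdot_lform nsq_1B SE.
    have -> : (2 * n.+1.-1 + 1 = K.+1)%N by rewrite addn1.
    rewrite NK -[(2 * n.+1.-1)%N]/K /swap_adj upd_same.
    have ne : K != K.+1 by rewrite ltn_eqF.
    rewrite (upd_other _ _ ne) upd_same.
    rewrite /sumsq /tailsq big_mkord; congr (_ * _ `^ _); first by rewrite /=; ring.
    by rewrite -natr1 /K natrM; field.
  rewrite E NK; exact: (H r r1 (fun=> 0)).
(* Since 1 - r^2 = (1 - |r|)(1 + |r|) is at most 2 (1 - |r|), passing from |r| to its square costs
   the factor (1/2)^(-m) in the constant. *)
rewrite lee_fin -mulrA ler_wpM2l ?(ltW c0)// -powRM ?invr_ge0 ?subr_ge0 ?(ltW a1)//.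
have r0 := normr_ge0 r.
have rr : `|r| ^+ 2 = vnorm2 a by rewrite real_normK ?num_real.
apply: le_powR_npos; last by rewrite oppr_le0 ltW.
  by rewrite mulr_gt0// subr_gt0.
rewrite -rr; nra.
Qed.

End forelli_rudin.

(** * Powers on the right half-plane *)

Section complex_power.
Context {R : realType}.
Local Notation C := (complex R).

Lemma cabsE (w : C) : cabs w = ComplexField.Normc.normc w.
Proof. by case: w. Qed.

Lemma cabsM (w z : C) : cabs (w * z) = cabs w * cabs z.
Proof. by rewrite !cabsE ComplexField.Normc.normcM. Qed.

Lemma cabsD (w z : C) : cabs (w + z) <= cabs w + cabs z.
Proof. by rewrite !cabsE le_normcD. Qed.

Lemma cabsN (w : C) : cabs (- w) = cabs w.
Proof. by rewrite !cabsE normcN. Qed.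

Lemma cabs0 : cabs (0 : C) = 0.
Proof. by rewrite cabsE ComplexField.Normc.normc0. Qed.

Lemma cabs_eq0 (w : C) : cabs w = 0 -> w = 0.
Proof. by rewrite cabsE; exact: ComplexField.Normc.eq0_normc. Qed.

Lemma cabs_real (x : R) : cabs (Complex x 0) = `|x|.
Proof. by rewrite /= expr0n addr0 sqrtr_sqr. Qed.

Lemma cabs_conj (w : C) : cabs (cconj w) = cabs w.
Proof. by case: w => x y /=; rewrite sqrrN. Qed.

Lemma normr_Re_le (w : C) : `|complex.Re w| <= cabs w.
Proof.
by case: w => x y /=; rewrite -sqrtr_sqr ler_wsqrtr// lerDl sqr_ge0.
Qed.

Lemma normr_Im_le (w : C) : `|complex.Im w| <= cabs w.
Proof.
by case: w => x y /=; rewrite -sqrtr_sqr ler_wsqrtr// lerDr sqr_ge0.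
Qed.

(** Turns a bound on a modulus into a bound on a real part, to which the real mean value theorem and
    real integration apply. *)
Lemma cabs_unit_phase (w : C) : exists k : C, cabs k <= 1 /\ complex.Re (k * w) = cabs w.
Proof.
have [w0|w0] := eqVneq (cabs w) 0.
  by exists 0; rewrite cabs0 mul0r w0.
exists (Complex (cabs w)^-1 0 * cconj w); split.
  rewrite cabsM cabs_real cabs_conj ger0_norm ?invr_ge0 ?cabs_ge0//.
  by rewrite mulVf.
have := cabs_sqr w; case: w w0 => x y; set c := cabs _ => c0 /=.
rewrite /nsq /= => cE; rewrite !mul0r !subr0 addr0.
transitivity (c^-1 * (x ^+ 2 + y ^+ 2)); first by ring.
by rewrite -cE; field.
Qed.

(* [cpowN s u] is [u ^ (- s)] on the right half-plane (principal branch). *)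
Definition cpowN (s : R) (u : C) : C :=
  let: Complex x y := u in
  Complex ((x ^+ 2 + y ^+ 2) `^ (- (s / 2)) * cos (s * atan (y / x)))
          (- ((x ^+ 2 + y ^+ 2) `^ (- (s / 2)) * sin (s * atan (y / x)))).

Lemma cabs_cpowN s u : cabs (cpowN s u) = nsq u `^ (- (s / 2)).
Proof.
case: u => x y; rewrite /cpowN /nsq /= sqrrN !exprMn -mulrDr cos2Dsin2 mulr1.
by rewrite sqrtr_sqr ger0_norm// powR_ge0.
Qed.

Lemma cpowN_real s x : 0 < x -> cpowN s (Complex x 0) = Complex (x `^ (- s)) 0.
Proof.
move=> x0; rewrite /cpowN mul0r atan0 mulr0 cos0 sin0 mulr0 mulr1 oppr0 expr0n addr0.
rewrite -(@powR_mulrn _ x 2 (ltW x0)) -powRrM; congr (Complex (_ `^ _) _); by field.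
Qed.

(** This is u^(-s-1) = u^(-s) conj(u) / |u|^2, expressed through the same angle as [cpowN s], so
    that it can be matched with the derivative of u^(-s). *)
Lemma cpowNS s x y : 0 < x -> cpowN (s + 1) (Complex x y) =
  let q := (x ^+ 2 + y ^+ 2) `^ (- (s / 2) - 1) in
  let c := cos (s * atan (y / x)) in let d := sin (s * atan (y / x)) in
  Complex (q * (x * c - y * d)) (- (q * (x * d + y * c))).
Proof.
move=> x0; rewrite /cpowN /=; set Q := x ^+ 2 + y ^+ 2; set q := Q `^ (- (s / 2) - 1).
set c := cos (s * _); set d := sin (s * _).
have Q0 : 0 < Q by rewrite ltr_wpDr ?sqr_ge0// exprn_gt0.
have sQ0 : 0 < Num.sqrt Q by rewrite sqrtr_gt0.
have cE : cos (atan (y / x)) = x / Num.sqrt Q.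
  rewrite cos_atan.
  have -> : 1 + (y / x) ^+ 2 = Q / x ^+ 2 by rewrite /Q; field; rewrite gt_eqF.
  rewrite sqrtrM ?(ltW Q0)// sqrtrV ?sqr_ge0// sqrtr_sqr gtr0_norm//.
  by rewrite invfM invrK mulrC.
have sE : sin (atan (y / x)) = y / Num.sqrt Q.
  have : tan (atan (y / x)) * cos (atan (y / x)) = sin (atan (y / x)).
    rewrite /tan divfK// cE mulf_neq0// ?invr_neq0// gt_eqF//.
  move=> <-; rewrite atanK cE; field; rewrite !gt_eqF//.
have qE : Q `^ (- ((s + 1) / 2)) = q * Num.sqrt Q.
  rewrite /q -powR12_sqrt ?(ltW Q0)// -gt0_powRD//; congr (_ `^ _); by field.
have nQ := lt0r_neq0 sQ0.
rewrite (mulrDl s 1 (atan _)) mul1r cosD sinD cE sE -/c -/d qE; congr Complex; by field.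
Qed.

(** The function is Re (k u^(-s)) in real coordinates, with k = k1 + i k2 and u moving on a line
    with velocity p + i q. *)
Lemma is_derive_polar (s x0 y0 p q r : R) (k1 k2 : R) : 0 < x0 + r * p ->
  let X := x0 + r * p in let Y := y0 + r * q in
  let e := (X ^+ 2 + Y ^+ 2) `^ (- (s / 2) - 1) in
  let c := cos (s * atan (Y / X)) in let d := sin (s * atan (Y / X)) in
  is_derive r 1 (fun r : R => ((x0 + r * p) ^+ 2 + (y0 + r * q) ^+ 2) `^ (- (s / 2)) *
     (k1 * cos (s * atan ((y0 + r * q) / (x0 + r * p))) +
      k2 * sin (s * atan ((y0 + r * q) / (x0 + r * p)))) : R^o)
   (- s * e * (k1 * ((X * c - Y * d) * p + (X * d + Y * c) * q) +
               k2 * ((X * d + Y * c) * p - (X * c - Y * d) * q))).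
Proof.
move=> X0 X Y e c d.
have Q0 : 0 < X ^+ 2 + Y ^+ 2 by rewrite ltr_wpDr ?sqr_ge0// exprn_gt0.
have Xn0 : X != 0 by rewrite gt_eqF.
have Qn0 : X ^+ 2 + Y ^+ 2 != 0 by rewrite gt_eqF.
have dlin (a b : R) : is_derive r 1 (fun r : R => a + r * b : R) b.
  have H := is_deriveD (is_derive_cst (a : R) (r : R) 1)
    (is_deriveM (is_derive_id (r : R) 1) (is_derive_cst (b : R) (r : R) 1)).
  by apply: (is_derive_eq H); rewrite /= !(scaler0, add0r) /GRing.scale/= mulr1.
have dX := dlin x0 p; have dY := dlin y0 q.
have dQ : is_derive r 1 (fun r : R => (x0 + r * p) ^+ 2 + (y0 + r * q) ^+ 2 : R)
    (2 * (X * p + Y * q)).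
  have H := is_deriveD (is_deriveX 2 dX) (is_deriveX 2 dY).
  by apply: (is_derive_eq H); rewrite /= /GRing.scale/= !expr1 -/X -/Y; ring.
have dV : is_derive r 1 (fun r : R => (y0 + r * q) / (x0 + r * p) : R)
    ((X * q - Y * p) / X ^+ 2).
  have H := is_deriveM dY (@is_deriveV R (fun r : R => x0 + r * p) r p 1 Xn0 dX).
  by apply: (is_derive_eq H); rewrite /= /GRing.scale/= -/X -/Y; field.
have dT : is_derive r 1 (fun r : R => s * atan ((y0 + r * q) / (x0 + r * p)) : R)
    (s * ((X * q - Y * p) / (X ^+ 2 + Y ^+ 2))).
  have H := is_deriveZ s (@is_derive1_comp R (@atan R) (fun r : R => (y0 + r * q) / (x0 + r * p)) r _ _ (is_derive1_atan (Y / X)) dV).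
  apply: (is_derive_eq H); rewrite /= /GRing.scale/=; field.
  by rewrite Qn0.
have dP : is_derive r 1 (fun r : R => ((x0 + r * p) ^+ 2 + (y0 + r * q) ^+ 2) `^ (- (s / 2)) : R)
    (- s * e * (X * p + Y * q)).
  have H := @is_derive1_comp R (@powR R ^~ (- (s / 2))) (fun r : R => (x0 + r * p) ^+ 2 + (y0 + r * q) ^+ 2) r _ _ (is_derive1_powR (- (s / 2)) Q0) dQ.
  by apply: (is_derive_eq H); rewrite /= -/e; field.
have dC := @is_derive1_comp R (@cos R) (fun r : R => s * atan ((y0 + r * q) / (x0 + r * p))) r _ _ (is_derive_cos _) dT.
have dS := @is_derive1_comp R (@sin R) (fun r : R => s * atan ((y0 + r * q) / (x0 + r * p))) r _ _ (is_derive_sin _) dT.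
have H := is_deriveM dP (is_deriveD (is_deriveZ k1 dC) (is_deriveZ k2 dS)).
apply: (is_derive_eq H); rewrite /= /GRing.scale/= -/X -/Y -/c -/d.
have -> : (X ^+ 2 + Y ^+ 2) `^ (- (s / 2)) = e * (X ^+ 2 + Y ^+ 2).
  by rewrite -[X in _ = _ * X]powRr1 ?(ltW Q0)// -gt0_powRD// subrK.
rewrite -[X in _ + X * _ = _]/(k1 * c + k2 * d).
by field.
Qed.

Lemma is_derive_cpowN s (k u t : C) (r : R) :
  0 < complex.Re (u + Complex r 0 * t) ->
  is_derive r 1 (fun r : R => complex.Re (k * cpowN s (u + Complex r 0 * t)) : R^o)
    (complex.Re (k * (Complex (- s) 0 * t) * cpowN (s + 1) (u + Complex r 0 * t))).
Proof.
case: k u t => k1 k2 [x y] [p q].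
have E (r' : R) : Complex x y + Complex r' 0 * Complex p q = Complex (x + r' * p) (y + r' * q).
  by apply/eqP; rewrite eq_complex /= !mul0r subr0 addr0 !eqxx.
rewrite E; under eq_fun do rewrite E.
rewrite [complex.Re _]/= => X0.
have H := @is_derive_polar s x y p q r k1 k2 X0.
have -> : (fun r : R => complex.Re (Complex k1 k2 * cpowN s (Complex (x + r * p) (y + r * q)))) =
    (fun r : R => ((x + r * p) ^+ 2 + (y + r * q) ^+ 2) `^ (- (s / 2)) *
     (k1 * cos (s * atan ((y + r * q) / (x + r * p))) +
      k2 * sin (s * atan ((y + r * q) / (x + r * p))))).
  by apply/funext => r' /=; ring.
apply: (is_derive_eq H); rewrite cpowNS//=.
move: (_ `^ _) (cos _) (sin _) => e c d.
by ring.
Qed.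

(** A phase makes the remainder the real part of a function on the segment from u to u + t, and two
    uses of the mean value theorem replace Taylor's formula, losing only its factor 1/2. The
    assumption on [e] keeps the segment where the real part is at least [e]; the bound then depends
    on the centre only through [e], hence is uniform over the kernels. *)
Lemma cpowN_taylor s (u t : C) (e : R) : 0 < s -> 0 < e ->
  e + cabs t <= complex.Re u ->
  cabs (cpowN s (u + t) - cpowN s u - Complex (- s) 0 * t * cpowN (s + 1) u) <=
    s * (s + 1) * e `^ (- (s + 2)) * cabs t ^+ 2.
Proof.
move=> s0 e0 eu.
have s10 : 0 < s + 1 by rewrite addr_gt0.
have [k [k1 <-]] := cabs_unit_phase (cpowN s (u + t) - cpowN s u - Complex (- s) 0 * t * cpowN (s + 1) u).
pose us r := u + Complex r 0 * t.
have us1 : us 1 = u + t by rewrite /us mul1r.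
have us0 : us 0 = u by rewrite /us mul0r addr0.
have Re_us r : 0 <= r -> r <= 1 -> e <= complex.Re (us r).
  move=> r0 r1; apply: (@le_trans _ _ (complex.Re u - `|complex.Re t|)).
    by have := normr_Re_le t; lra.
  rewrite /us; case: u t {us us1 us0 eu} => x y [p q] /=.
  rewrite mul0r subr0 lerD2l lerNl -mulrN.
  have h := ler_norm (- p); rewrite normrN in h.
  have h0 := normr_ge0 p.
  by apply: (@le_trans _ _ (r * `|p|)); [rewrite ler_wpM2l|rewrite ler_piMl].
pose f r := complex.Re (k * cpowN s (us r)).
pose k' := k * (Complex (- s) 0 * t).
pose f1 r := complex.Re (k' * cpowN (s + 1) (us r)).
pose k'' := k' * (Complex (- (s + 1)) 0 * t).
pose f2 r := complex.Re (k'' * cpowN (s + 1 + 1) (us r)).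
have us_gt0 r : 0 <= r -> r <= 1 -> 0 < complex.Re (us r).
  by move=> r0 r1; apply: lt_le_trans (Re_us r r0 r1).
have df (r : R) : 0 <= r -> r <= 1 -> is_derive r 1 (f : R -> R) (f1 r).
  by move=> r0 r1; apply: is_derive_cpowN; exact: us_gt0.
have df1 (r : R) : 0 <= r -> r <= 1 -> is_derive r 1 (f1 : R -> R) (f2 r).
  by move=> r0 r1; apply: is_derive_cpowN; exact: us_gt0.
have mvt (g dg : R -> R) (b : R) : 0 < b -> b <= 1 ->
    (forall r : R, 0 <= r -> r <= 1 -> is_derive r 1 (g : R -> R) (dg r)) ->
    exists2 c, c \in `]0, b[%R & g b - g 0 = dg c * (b - 0).
  move=> b0 b1 dgd; apply: MVT => //.
    by move=> r; rewrite in_itv/= => /andP[r0 rb]; apply: dgd; [exact: ltW|rewrite ltW// (lt_le_trans rb)].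
  apply/continuous_in_subspaceT => r; rewrite inE/= in_itv/= => /andP[r0 rb].
  apply: differentiable_continuous; apply/derivable1_diffP.
  by have [] := dgd r r0 (le_trans rb b1).
have [c] := mvt f f1 1 ltr01 (lexx _) df.
rewrite in_itv/= => /andP[c0 c1]; rewrite subr0 mulr1 => E1.
have [d] := mvt f1 f2 c c0 (ltW c1) df1.
rewrite in_itv/= => /andP[d0 d1]; rewrite subr0 => E2.
have -> : complex.Re (k * (cpowN s (u + t) - cpowN s u - Complex (- s) 0 * t * cpowN (s + 1) u)) =
    f 1 - f 0 - f1 0.
  rewrite /f /f1 us0 us1 !mulrBr -/(k' * _) mulrA -/k'.
  by move: (k * _) (k * _) (k' * _) => [? ?] [? ?] [? ?].
rewrite E1 E2.
apply: le_trans (ler_norm _) _; rewrite normrM.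
have d0' := ltW d0; have d1' := ltW (lt_trans d1 c1).
have F2 : `|f2 d| <= s * (s + 1) * e `^ (- (s + 2)) * cabs t ^+ 2.
  apply: le_trans (normr_Re_le _) _.
  rewrite /k'' /k' !cabsM !cabs_real !normrN !gtr0_norm// cabs_cpowN.
  have T0 := cabs_ge0 t.
  have P : nsq (us d) `^ (- ((s + 1 + 1) / 2)) <= e `^ (- (s + 2)).
    have -> : e `^ (- (s + 2)) = (e ^+ 2) `^ (- ((s + 1 + 1) / 2)).
      by rewrite -(@powR_mulrn _ e 2 (ltW e0)) -powRrM; congr (_ `^ _); field.
    apply: le_powR_npos; first exact: exprn_gt0.
      apply: (@le_trans _ _ (complex.Re (us d) ^+ 2)); last by rewrite lerDl sqr_ge0.
      by rewrite ler_pXn2r// ?nnegrE ?(ltW e0)//; [exact: Re_us|rewrite ltW// us_gt0].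
    by rewrite oppr_le0 divr_ge0//; lra.
  apply: (@le_trans _ _ (1 * (s * cabs t) * ((s + 1) * cabs t) * e `^ (- (s + 2)))).
    rewrite ler_pM ?powR_ge0//.
      by rewrite !mulr_ge0 ?cabs_ge0// ltW.
    by rewrite ler_wpM2r ?mulr_ge0 ?(ltW s10)// ler_wpM2r// mulr_ge0// ltW.
  by rewrite le_eqVlt; apply/orP; left; apply/eqP; ring.
apply: le_trans F2; rewrite (ger0_norm (ltW c0)).
by rewrite ler_piMr ?normr_ge0 ?(ltW c1).
Qed.

End complex_power.

(** * Absolutely convergent complex series *)

Section complex_series.
Context {R : realType}.
Local Notation C := (complex R).
Local Notation cnt := (@counting nat R).
Implicit Types (u v : nat -> C).

Definition l1norm (u : nat -> C) : \bar R := (\sum_(k <oo) (cabs (u k))%:E)%E.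

Definition csummable u : Prop := (l1norm u < +oo)%E.

(** Series are taken as integrals against the counting measure, so that linearity and the bound by
    the sum of moduli are inherited from integration. *)
Definition csum u : C :=
  Complex (\int[cnt]_k complex.Re (u k)) (\int[cnt]_k complex.Im (u k)).

Lemma l1norm_ge0 u : (0 <= l1norm u)%E.
Proof. by apply: nneseries_ge0 => k _ _; rewrite lee_fin cabs_ge0. Qed.

Lemma l1norm_count u : l1norm u = (\int[cnt]_k (cabs (u k))%:E)%E.
Proof. by rewrite ge0_integral_count// => k; rewrite lee_fin cabs_ge0. Qed.

Lemma le_csummable c u v : (forall k, cabs (u k) <= c * cabs (v k)) ->
  csummable v -> csummable u.
Proof.
move=> uv sv.
have sv' : (l1norm v \is a fin_num) by rewrite ge0_fin_numE ?l1norm_ge0.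
apply: (@le_lt_trans _ _ (`|c|%:E * l1norm v)%E).
  rewrite -nneseriesZl; last by move=> k _; rewrite lee_fin cabs_ge0.
  apply: lee_nneseries => [k _ _|k _]; first by rewrite lee_fin cabs_ge0.
  rewrite -EFinM lee_fin; apply: le_trans (uv k) _.
  by rewrite ler_wpM2r ?cabs_ge0// ler_norm.
by rewrite -(fineK sv') -EFinM ltry.
Qed.

Lemma csummable_Re_integrable u : csummable u ->
  cnt.-integrable setT (EFin \o (fun k => complex.Re (u k))).
Proof.
move=> su; apply/integrableP; split; first by [].
apply: le_lt_trans su; rewrite l1norm_count; apply: ge0_le_integral => //.
by move=> k _; rewrite /= lee_fin normr_Re_le.
Qed.

Lemma csummable_Im_integrable u : csummable u ->
  cnt.-integrable setT (EFin \o (fun k => complex.Im (u k))).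
Proof.
move=> su; apply/integrableP; split; first by [].
apply: le_lt_trans su; rewrite l1norm_count; apply: ge0_le_integral => //.
by move=> k _; rewrite /= lee_fin normr_Im_le.
Qed.

Lemma csummableD u v : csummable u -> csummable v -> csummable (fun k => u k + v k).
Proof.
move=> su sv; apply: (@le_lt_trans _ _ (l1norm u + l1norm v)%E); last exact: lte_add_pinfty.
rewrite -nneseriesD; try by move=> k _; rewrite lee_fin cabs_ge0.
apply: lee_nneseries => [k _ _|k _]; first by rewrite lee_fin cabs_ge0.
by rewrite -EFinD lee_fin cabsD.
Qed.

Lemma csummableZ c u : csummable u -> csummable (fun k => c * u k).
Proof. by apply: (@le_csummable (cabs c)) => k; rewrite cabsM. Qed.

Lemma csumD u v : csummable u -> csummable v ->
  csum (fun k => u k + v k) = csum u + csum v.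
Proof.
move=> su sv; rewrite /csum.
have -> : (fun k => complex.Re (u k + v k)) = fun k => complex.Re (u k) + complex.Re (v k).
  by apply/funext => k; case: (u k) (v k) => [? ?] [].
have -> : (fun k => complex.Im (u k + v k)) = fun k => complex.Im (u k) + complex.Im (v k).
  by apply/funext => k; case: (u k) (v k) => [? ?] [].
rewrite !RintegralD//; try exact: csummable_Re_integrable; exact: csummable_Im_integrable.
Qed.

Lemma csumZ c u : csummable u -> csum (fun k => c * u k) = c * csum u.
Proof.
move=> su; have iR := csummable_Re_integrable su; have iI := csummable_Im_integrable su.
case: c => x y; rewrite /csum.
have -> : (fun k => complex.Re (Complex x y * u k)) =
    fun k => x * complex.Re (u k) - y * complex.Im (u k).
  by apply/funext => k; case: (u k).
have -> : (fun k => complex.Im (Complex x y * u k)) =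
    fun k => x * complex.Im (u k) + y * complex.Re (u k).
  by apply/funext => k; case: (u k).
have iZ (z : R) (f : nat -> R) : cnt.-integrable setT (EFin \o f) ->
    cnt.-integrable setT (EFin \o (fun k => z * f k)).
  by move=> i; exact: (integrableZl measurableT z i).
rewrite RintegralB//; try exact: iZ.
rewrite RintegralD//; try exact: iZ.
by rewrite !RintegralZl.
Qed.

Lemma csumN u : csummable u -> csum (fun k => - u k) = - csum u.
Proof.
move=> su; rewrite -[RHS]mulN1r -csumZ//; congr csum; apply/funext => k.
by rewrite mulN1r.
Qed.

Lemma csumB u v : csummable u -> csummable v ->
  csum (fun k => u k - v k) = csum u - csum v.
Proof.
move=> su sv; rewrite csumD// ?csumN//.
by apply: (@le_csummable 1) sv => k; rewrite mul1r cabsN.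
Qed.

Lemma csum_cabs_le u : csummable u -> ((cabs (csum u))%:E <= l1norm u)%E.
Proof.
move=> su; have [k [k1 <-]] := cabs_unit_phase (csum u).
rewrite -csumZ// /=.
have sk := csummableZ k su.
apply: (@le_trans _ _ (\int[cnt]_j (complex.Re (k * u j))%:E)%E).
  rewrite /Rintegral fineK//; exact: integrable_fin_num (csummable_Re_integrable sk).
apply: le_trans (lee_abs _) _; apply: le_trans (le_abse_integral _ _ _) _ => //.
rewrite l1norm_count; apply: ge0_le_integral => //= j _; rewrite lee_fin.
apply: le_trans (normr_Re_le _) _; rewrite cabsM.
by rewrite ler_piMl ?cabs_ge0.
Qed.

Lemma nneseries_recS (g : nat -> \bar R) : (forall k, 0 <= g k)%E ->
  (\sum_(k <oo) g k = g 0%N + \sum_(k <oo) g k.+1)%E.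
Proof.
move=> g0; rewrite nneseries_recl// -nneseries_addn//; congr (_ + _)%E.
by apply: eq_eseriesr => k _; rewrite addn1.
Qed.

(** Holds for the positive and negative parts, whose integrals are nonnegative series, and is
    recombined from them by finiteness. *)
Lemma integral_counting_recl (f : nat -> R) : cnt.-integrable setT (EFin \o f) ->
  \int[cnt]_k f k = f 0%N + \int[cnt]_k f k.+1.
Proof.
move=> fi.
have fS : cnt.-integrable setT (EFin \o (fun k => f k.+1)).
  apply/integrableP; split; first by [].
  move/integrableP : fi => [_]; apply: le_lt_trans.
  rewrite !ge0_integral_count//.
  by rewrite [leRHS]nneseries_recS// leeDr.
have P (g : nat -> \bar R) : (forall k, 0 <= g k)%E ->
    (\int[cnt]_k g k = g 0%N + \int[cnt]_k g k.+1)%E.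
  by move=> g0; rewrite !ge0_integral_count// nneseries_recS.
have F h : cnt.-integrable setT (EFin \o h) ->
  (\int[cnt]_k ((EFin \o h)^\+ k) \is a fin_num)%E /\ (\int[cnt]_k ((EFin \o h)^\- k) \is a fin_num)%E.
  by move=> hi; split; [exact: integrable_pos_fin_num|exact: integrable_neg_fin_num].
have [p1 n1] := F _ fi; have [p2 n2] := F _ fS.
have D h (hi : cnt.-integrable setT (EFin \o h)) : \int[cnt]_k h k =
    fine (\int[cnt]_k ((EFin \o h)^\+ k))%E - fine (\int[cnt]_k ((EFin \o h)^\- k))%E.
  by have [p n] := F _ hi; rewrite /Rintegral integralE fineB.
rewrite (D _ fi) (D _ fS) (P (EFin \o f)^\+%E) ?(P (EFin \o f)^\-%E)//.
have -> : (fun k => (EFin \o f)^\+%E k.+1) = (EFin \o (fun k => f k.+1))^\+%E.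
  by apply/funext => k; rewrite !funeposE.
have -> : (fun k => (EFin \o f)^\-%E k.+1) = (EFin \o (fun k => f k.+1))^\-%E.
  by apply/funext => k; rewrite !funenegE.
have fp : (EFin \o f)^\+%E 0%N \is a fin_num.
  by rewrite funeposE /= -EFin_max.
have fn : (EFin \o f)^\-%E 0%N \is a fin_num.
  by rewrite funenegE /= -EFin_max.
rewrite (fineD fp p2) (fineD fn n2).
rewrite opprD addrACA; congr (_ + _).
rewrite funeposE funenegE /= -!EFin_max/= /Num.max.
by case: ifPn; case: ifPn => /=; lra.
Qed.

Lemma csum_recl u : csummable u -> csum u = u 0%N + csum (fun k => u k.+1).
Proof.
move=> su; rewrite /csum (integral_counting_recl (csummable_Re_integrable su)).
rewrite (integral_counting_recl (csummable_Im_integrable su)).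
by case: (u 0%N).
Qed.

End complex_series.

(** * Neumann series in weighted l1 *)

Section neumann.
Context {R : realType}.
Local Notation C := (complex R).
Variables (W : nat -> R) (A : nat -> nat -> C) (q : R).
Hypotheses (W0 : forall k, 0 < W k) (q0 : 0 <= q) (q1 : q < 1).
Hypothesis Aq : forall j, (\sum_(k <oo) (W k * cabs (A k j))%:E <= (q * W j)%:E)%E.

Definition wnorm (u : nat -> C) : \bar R := l1norm (fun k => Complex (W k) 0 * u k).

Lemma wnormE u : wnorm u = (\sum_(k <oo) (W k * cabs (u k))%:E)%E.
Proof. by apply: eq_eseriesr => k _; rewrite cabsM cabs_real gtr0_norm. Qed.

Let term_le (f : nat -> R) k : (forall k, 0 <= f k) -> ((f k)%:E <= \sum_(j <oo) (f j)%:E)%E.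
Proof.
move=> f0; rewrite (nneseriesD1 (n := k))//; last by move=> j _; rewrite lee_fin.
by rewrite leeDl// nneseries_ge0// => j _ _; rewrite lee_fin.
Qed.

Lemma le_wnorm u k : ((W k * cabs (u k))%:E <= wnorm u)%E.
Proof.
rewrite wnormE; apply: (term_le (f := fun k => W k * cabs (u k))) => j.
by rewrite mulr_ge0 ?cabs_ge0// ltW.
Qed.

Lemma wnormN u : wnorm (fun k => - u k) = wnorm u.
Proof. by rewrite !wnormE; apply: eq_eseriesr => k _; rewrite cabsN. Qed.

Definition matop (u : nat -> C) (k : nat) : C := csum (fun j => A k j * u j).

(** A single entry is at most its weighted column sum, so |A k j| is bounded by q W_j / W_k and the
    row series is dominated by the norm of [u]. *)
Lemma matop_csummable u k : csummable (fun j => Complex (W j) 0 * u j) ->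
  csummable (fun j => A k j * u j).
Proof.
apply: (@le_csummable R (q / W k)) => j; rewrite !cabsM cabs_real gtr0_norm//.
rewrite mulrA ler_wpM2r ?cabs_ge0// mulrAC ler_pdivlMr// mulrC -lee_fin.
apply: le_trans (Aq j); apply: (term_le (f := fun k => W k * cabs (A k j))) => i.
by rewrite mulr_ge0 ?cabs_ge0// ltW.
Qed.

(** In a weighted l1 space the operator norm is read off the columns: exchanging the two nonnegative
    sums isolates the column sum of index [j], which is at most q W_j. *)
Lemma wnorm_matop u : (wnorm u < +oo)%E -> (wnorm (matop u) <= q%:E * wnorm u)%E.
Proof.
move=> su; rewrite !wnormE.
have P (z : C) k : 0 <= W k * cabs z by rewrite mulr_ge0 ?cabs_ge0// ltW.
apply: (@le_trans _ _ (\sum_(k <oo) \sum_(j <oo) (W k * (cabs (A k j) * cabs (u j)))%:E)%E).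
  apply: lee_nneseries => [k _ _|k _]; first by rewrite lee_fin P.
  under [leRHS]eq_eseriesr do rewrite EFinM.
  rewrite nneseriesZl; last by move=> j _; rewrite lee_fin mulr_ge0 ?cabs_ge0.
  rewrite EFinM lee_wpmul2l ?lee_fin ?(ltW (W0 k))//.
  apply: le_trans (csum_cabs_le (matop_csummable k su)) _.
  by rewrite /l1norm; under eq_eseriesr do rewrite cabsM.
rewrite nneseries_interchange; last first.
  by move=> k j; rewrite lee_fin !mulr_ge0 ?cabs_ge0// ltW.
rewrite -nneseriesZl; last by move=> j _; rewrite lee_fin P.
apply: lee_nneseries => [j _ _|j _].
  by apply: nneseries_ge0 => k _ _; rewrite lee_fin !mulr_ge0 ?cabs_ge0// ltW.
under eq_eseriesr do rewrite mulrA mulrC EFinM.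
rewrite nneseriesZl; last by move=> k _; rewrite lee_fin P.
apply: (@le_trans _ _ ((cabs (u j))%:E * (q * W j)%:E)%E).
  by rewrite lee_wpmul2l ?lee_fin ?cabs_ge0.
by rewrite -!EFinM lee_fin le_eqVlt; apply/orP; left; apply/eqP; ring.
Qed.

Lemma nneseries_geometric_le (I : nat) (c : R) : 0 <= c ->
  (\sum_(i <oo) (q ^+ (I + i) * c)%:E <= (q ^+ I * c / (1 - q))%:E)%E.
Proof.
move=> c0; have q1' : 0 < 1 - q by rewrite subr_gt0.
apply: lime_le; first by apply: is_cvg_nneseries => i _ _; rewrite lee_fin mulr_ge0 ?exprn_ge0.
apply: nearW => n; rewrite sumEFin lee_fin.
rewrite ler_pdivlMr//.
have -> : (\sum_(0 <= i < n) q ^+ (I + i) * c) * (1 - q) = q ^+ I * c * (1 - q ^+ n).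
  elim: n => [|n IH]; first by rewrite big_geq// mul0r expr0 subrr mulr0.
  by rewrite big_nat_recr//= mulrDl IH exprD exprS; ring.
by rewrite ler_piMr ?mulr_ge0 ?exprn_ge0// lerBlDr lerDl exprn_ge0.
Qed.

(** Let [it i] be the i-th iterate of minus the operator on [v], and [tl I] the tail of their series
    from I on. The residual tl I + A (tl I) - it I does not depend on I, yet at each index it is
    O(q^I). So it vanishes, and at I = 0 this is the equation for w = tl 0. *)
Lemma neumann (v : nat -> C) : (wnorm v < +oo)%E ->
  exists w, (wnorm w < +oo)%E /\ forall k, w k + matop w k = v k.
Proof.
move=> sv; pose S := fine (wnorm v).
have SE : wnorm v = S%:E by rewrite /S fineK// ge0_fin_numE ?l1norm_ge0.
have S0 : 0 <= S by rewrite fine_ge0 ?l1norm_ge0.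
have q1' : 0 < 1 - q by rewrite subr_gt0.
pose fix it i := if i is i'.+1 then fun k => - matop (it i') k else v.
have itS i : (wnorm (it i) <= (q ^+ i * S)%:E)%E.
  elim: i => [|i IH]; first by rewrite /= SE expr0 mul1r.
  rewrite /= wnormN; apply: le_trans (wnorm_matop _) _.
    by apply: le_lt_trans IH _; rewrite ltry.
  by rewrite exprS -mulrA EFinM lee_wpmul2l ?lee_fin.
have itfin i : (wnorm (it i) < +oo)%E by apply: le_lt_trans (itS i) _; rewrite ltry.
pose tl I k := csum (fun i => it (I + i)%N k).
have tlsum I k : csummable (fun i => it (I + i)%N k).
  apply: (@le_lt_trans _ _ (\sum_(i <oo) (q ^+ (I + i) * (S / W k))%:E)%E).
    apply: lee_nneseries => [i _ _|i _]; first by rewrite lee_fin cabs_ge0.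
    rewrite lee_fin mulrA ler_pdivlMr// mulrC -lee_fin.
    exact: le_trans (le_wnorm _ _) (itS _).
  apply: le_lt_trans (nneseries_geometric_le _ _) _; last by rewrite ltry.
  by rewrite divr_ge0// ltW.
have tlnorm I : (wnorm (tl I) <= (q ^+ I * S / (1 - q))%:E)%E.
  apply: le_trans (nneseries_geometric_le I S0).
  apply: (@le_trans _ _ (\sum_(k <oo) \sum_(i <oo) (W k * cabs (it (I + i)%N k))%:E)%E).
    rewrite wnormE; apply: lee_nneseries => [k _ _|k _].
      by rewrite lee_fin mulr_ge0 ?cabs_ge0// ltW.
    under [leRHS]eq_eseriesr do rewrite EFinM.
    rewrite nneseriesZl; last by move=> j _; rewrite lee_fin ?cabs_ge0.
    by rewrite EFinM lee_wpmul2l ?lee_fin ?(ltW (W0 k))//; exact: csum_cabs_le.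
  rewrite nneseries_interchange; last first.
    by move=> k j; rewrite lee_fin !mulr_ge0 ?cabs_ge0// ltW.
  apply: lee_nneseries => [i _ _|i _].
    by apply: nneseries_ge0 => k _ _; rewrite lee_fin !mulr_ge0 ?cabs_ge0// ltW.
  by rewrite -wnormE.
have tlfin I : (wnorm (tl I) < +oo)%E by apply: le_lt_trans (tlnorm I) _; rewrite ltry.
have tlS I k : tl I k = it I k + tl I.+1 k.
  rewrite /tl csum_recl// addn0; congr (_ + csum _); apply/funext => i.
  by rewrite addSnnS.
exists (tl 0%N); split => // k.
have step I : tl I k + matop (tl I) k - it I k =
    tl I.+1 k + matop (tl I.+1) k - it I.+1 k.
  have -> : matop (tl I) k = matop (it I) k + matop (tl I.+1) k.
    have s1 := matop_csummable k (itfin I); have s2 := matop_csummable k (tlfin I.+1).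
    rewrite /matop -csumD//.
    by congr csum; apply/funext => j; rewrite tlS mulrDr.
  have -> : it I.+1 k = - matop (it I) k by [].
  by rewrite tlS opprK; ring.
have r_const I : tl 0%N k + matop (tl 0%N) k - v k = tl I k + matop (tl I) k - it I k.
  by elim: I => [//|I ->]; exact: step.
(* The three summands bound the tail, its image under the operator and the iterate, each up to q^I;
   dividing by W k passes from the norm to the entry of index [k]. *)
pose M := (S / (1 - q) + S / (1 - q) + S) / W k.
have M0 : 0 <= M by rewrite divr_ge0 ?(ltW (W0 k))// !addr_ge0// divr_ge0// ltW.
have bnd I : cabs (tl 0%N k + matop (tl 0%N) k - v k) <= q ^+ I * M.
  rewrite (r_const I) /M mulrA ler_pdivlMr//.
  have h1 : W k * cabs (tl I k) <= q ^+ I * S / (1 - q).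
    by rewrite -lee_fin; exact: le_trans (le_wnorm _ _) (tlnorm _).
  have h2 : W k * cabs (matop (tl I) k) <= q ^+ I * S / (1 - q).
    rewrite -lee_fin; apply: le_trans (le_wnorm _ _) _.
    apply: le_trans (wnorm_matop (tlfin I)) _; apply: le_trans (tlnorm I).
    by rewrite -[leRHS]mul1e lee_wpmul2r ?l1norm_ge0// lee_fin ltW.
  have h3 : W k * cabs (it I k) <= q ^+ I * S.
    by rewrite -lee_fin; exact: le_trans (le_wnorm _ _) (itS _).
  apply: (@le_trans _ _ (W k * (cabs (tl I k) + cabs (matop (tl I) k) + cabs (it I k)))).
    rewrite mulrC ler_wpM2l ?(ltW (W0 k))//.
    apply: le_trans (cabsD _ _) _; rewrite cabsN lerD2r; exact: cabsD.
  have -> : q ^+ I * (S / (1 - q) + S / (1 - q) + S) =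
    q ^+ I * S / (1 - q) + q ^+ I * S / (1 - q) + q ^+ I * S by ring.
  by rewrite !mulrDr !lerD.
apply/eqP; rewrite -subr_eq0; apply/eqP/cabs_eq0/eqP.
rewrite eq_le cabs_ge0 andbT.
have cv : (fun I => q ^+ I * M) @ \oo --> (0 : R).
  by rewrite -[X in _ --> X](mul0r M); apply: cvgMl; apply: cvg_expr; rewrite ger0_norm.
rewrite -(cvg_lim (@Rhausdorff R) cv); apply: limr_ge; first by apply/cvg_ex; exists 0.
by apply: nearW => I; exact: bnd.
Qed.

End neumann.

(** * Sums of kernels *)

Section hermitian.
Context {R : realType}.
Local Notation C := (complex R).
Variable n : nat.
Implicit Types (z w a h : 'rV[C]_n).

Lemma vnorm2_ge0 z : 0 <= vnorm2 z.
Proof. by apply: sumr_ge0 => j _; exact: sqr_ge0. Qed.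

Lemma cabs_sum (F : 'I_n -> C) : cabs (\sum_j F j) <= \sum_j cabs (F j).
Proof.
elim/big_ind2 : _ => //; first by rewrite cabs0.
by move=> x1 x2 y1 y2 h1 h2; apply: le_trans (cabsD _ _) _; exact: lerD.
Qed.

(** The arithmetic-geometric inequality in each coordinate stands in for Cauchy-Schwarz. For |a| < 1
    it bounds Re (1 - z.conj(a)) from below independently of [a]. *)
Lemma cabs_hdot_le_mean z a : cabs (hdot z a) <= (vnorm2 z + vnorm2 a) / 2.
Proof.
apply: le_trans (cabs_sum _) _; rewrite /vnorm2 -big_split/= mulr_suml.
apply: ler_sum => j _; rewrite cabsM cabs_conj.
have := sqr_ge0 (cabs (z ord0 j) - cabs (a ord0 j)); lra.
Qed.

Lemma cabs_coord_le z j : cabs (z ord0 j) <= vnorm z.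
Proof.
rewrite -(@ler_pXn2r _ 2) ?nnegrE ?cabs_ge0 ?sqrtr_ge0// sqr_sqrtr ?vnorm2_ge0//.
rewrite /vnorm2 (bigD1 j)//= lerDl sumr_ge0// => i _; exact: sqr_ge0.
Qed.

Lemma hdotDl z w a : hdot (z + w) a = hdot z a + hdot w a.
Proof. by rewrite /hdot -big_split; apply: eq_bigr => j _; rewrite !mxE mulrDl. Qed.

Lemma Re_one_sub_hdot z a : vnorm2 a < 1 ->
  (1 - vnorm2 z) / 2 <= complex.Re (1 - hdot z a).
Proof.
move=> a1; have h := cabs_hdot_le_mean z a.
have := le_trans (normr_Re_le (hdot z a)) h.
case: (hdot z a) => x y /=; have := ler_norm x; lra.
Qed.

Lemma hdot_self a : hdot a a = Complex (vnorm2 a) 0.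
Proof.
rewrite /hdot /vnorm2; elim/big_ind2 : _ => //.
  by move=> x1 x2 y1 y2 -> ->; rewrite -[RHS]/(Complex _ _); apply/eqP; rewrite eq_complex /= addr0 !eqxx.
move=> j _; rewrite cabs_sqr; case: (a ord0 j) => x y.
by rewrite /nsq; apply/eqP; rewrite eq_complex /=; apply/andP; split; apply/eqP; ring.
Qed.

End hermitian.

Lemma vnorm2_cvec (R : realType) n (x : nat -> R) : vnorm2 (cvec_of n x) = sumsq (2 * n) x.
Proof.
rewrite /vnorm2 /sumsq.
under eq_bigr do rewrite mxE cabs_sqr /nsq /=.
elim: n => [|n IH]; first by rewrite !big_ord0.
by rewrite big_ord_recr IH mulnS !big_ord_recr/= addn1 addrA.
Qed.

Section series_more.
Context {R : realType}.
Local Notation C := (complex R).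

Lemma csummable_tail (u : nat -> C) : csummable u -> csummable (fun k => u k.+1).
Proof.
apply: le_lt_trans; rewrite [leRHS]nneseries_recS; last by move=> k; rewrite lee_fin cabs_ge0.
by rewrite leeDr// lee_fin cabs_ge0.
Qed.

Lemma csum0 : csum (fun=> 0 : C) = 0.
Proof. by rewrite /csum /= /Rintegral !integral0. Qed.

Lemma csum_single k (u : nat -> C) : csummable u -> (forall j, j != k -> u j = 0) ->
  csum u = u k.
Proof.
elim: k u => [|k IH] u su u0; rewrite csum_recl//.
  rewrite (_ : (fun k => u k.+1) = fun=> 0) ?csum0 ?addr0//.
  by apply/funext => k; rewrite u0.
rewrite u0// add0r (IH (fun k => u k.+1))//; first exact: csummable_tail.
by move=> j jk; rewrite u0.
Qed.

Lemma csum_sum n (F : 'I_n -> nat -> C) : (forall i, csummable (F i)) ->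
  csummable (fun k => \sum_i F i k) /\ csum (fun k => \sum_i F i k) = \sum_i csum (F i).
Proof.
elim: n F => [|n IH] F sF.
  rewrite big_ord0; under eq_fun do rewrite big_ord0.
  split; last exact: csum0.
  by rewrite /csummable /l1norm eseries0 ?ltry// => i _ _; rewrite cabs0.
have [s1 e1] := IH (fun i => F (widen_ord (leqnSn n) i)) (fun i => sF _).
rewrite big_ord_recr/= -e1 -csumD//.
under eq_fun do rewrite big_ord_recr/=.
by split => //; exact: csummableD.
Qed.

End series_more.

(** * Holomorphy and weighted integral of a kernel series *)

Section synthesis.
Context {R : realType}.
Local Notation C := (complex R).
Variables (n : nat) (a : nat -> 'rV[C]_n.+1) (V : nat -> C) (s : R).
Hypotheses (a1 : forall j, vnorm2 (a j) < 1) (sV : csummable V) (s0 : 0 < s).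

(** The coefficients [V j] absorb the normalization: for V_j = w_j (1 - |a_j|^2)^s this is the sum
    of the w_j F_j. *)
Definition synth (z : 'rV[C]_n.+1) : C := csum (fun j => V j * cpowN s (1 - hdot z (a j))).

Lemma cabs_cpowN_le r (e : R) u : 0 <= r -> 0 < e -> e <= complex.Re u ->
  cabs (cpowN r u) <= e `^ (- r).
Proof.
move=> r0 e0 eu; rewrite cabs_cpowN.
have -> : e `^ (- r) = (e ^+ 2) `^ (- (r / 2)).
  by rewrite -(@powR_mulrn _ e 2 (ltW e0)) -powRrM; congr (_ `^ _); field.
apply: le_powR_npos; [exact: exprn_gt0| |by rewrite oppr_le0 divr_ge0].
apply: (@le_trans _ _ (complex.Re u ^+ 2)); last by rewrite lerDl sqr_ge0.
by rewrite ler_pXn2r// ?nnegrE ?(ltW e0)// (le_trans (ltW e0)).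
Qed.

Lemma csummable_cpowN r (e : R) (u : nat -> C) : 0 <= r -> 0 < e ->
  (forall j, e <= complex.Re (u j)) -> csummable (fun j => V j * cpowN r (u j)).
Proof.
move=> r0 e0 eu; apply: (@le_csummable R (e `^ (- r))) sV => j.
by rewrite cabsM mulrC ler_wpM2r ?cabs_ge0// cabs_cpowN_le.
Qed.

Lemma csummable_synth z : vnorm2 z < 1 -> csummable (fun j => V j * cpowN s (1 - hdot z (a j))).
Proof.
move=> z1; apply: (@csummable_cpowN s ((1 - vnorm2 z) / 2)) => [| |j].
- exact: ltW.
- by rewrite divr_gt0// subr_gt0.
- exact: Re_one_sub_hdot.
Qed.

Lemma cabs_hdot_le_norm h j : cabs (hdot h (a j)) <= n.+1%:R * vnorm h.
Proof.
apply: le_trans (cabs_sum _) _.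
rewrite mulr_natl -[X in _ *+ X]card_ord -sumr_const; apply: ler_sum => i _.
rewrite cabsM cabs_conj -[leRHS]mulr1; apply: ler_pM; rewrite ?cabs_ge0 ?cabs_coord_le//.
apply: le_trans (cabs_coord_le _ _) _.
by rewrite -[leRHS]sqrtr1 ler_wsqrtr// ltW.
Qed.

Lemma holomorphic_synth : holomorphic_on (@ball_n R n.+1) synth.
Proof.
move=> z z1; rewrite /ball_n /= in z1.
pose E := (1 - vnorm2 z) / 2.
have E0 : 0 < E by rewrite divr_gt0// subr_gt0.
pose u j := 1 - hdot z (a j).
have uE j : E <= complex.Re (u j) by exact: Re_one_sub_hdot.
(* [F i j] is the derivative of the j-th term with respect to z_i; its sum over j will be the i-th
   coefficient of the differential. *)
pose F (i : 'I_n.+1) j := (Complex s 0 * cconj (a j ord0 i)) * (V j * cpowN (s + 1) (u j)).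
have s10 : 0 <= s + 1 by rewrite addr_ge0// ltW.
have sP1 := csummable_cpowN s10 E0 uE.
have sF i : csummable (F i).
  apply: (@le_csummable R s) sP1 => j; rewrite /F [leLHS]cabsM (cabsM (Complex s 0)) cabs_real cabs_conj.
  rewrite gtr0_norm// ler_wpM2r ?cabs_ge0// ler_piMr ?(ltW s0)//.
  apply: le_trans (cabs_coord_le _ _) _.
  by rewrite -[leRHS]sqrtr1 ler_wsqrtr// ltW.
exists (\row_i csum (F i)) => eps eps0.
pose L : R := n.+1%:R.
have L0 : 0 < L by rewrite ltr0n.
pose S := fine (l1norm V).
have S0 : 0 <= S by rewrite fine_ge0 ?l1norm_ge0.
have SE : l1norm V = S%:E by rewrite /S fineK// ge0_fin_numE ?l1norm_ge0.
pose e := E / 2; have e0 : 0 < e by rewrite divr_gt0.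
pose K := s * (s + 1) * e `^ (- (s + 2)).
have K0 : 0 <= K by rewrite !mulr_ge0 ?powR_ge0// ltW.
have D0 : 0 < K * L ^+ 2 * S + 1 by apply: ltr_wpDl => //; do 2 apply: mulr_ge0 => //; exact: sqr_ge0.
(* The first bound keeps |h.conj(a_j)| below e, half of the available margin E, as [cpowN_taylor]
   needs. The second makes the quadratic remainder at most eps |h|; the added 1 keeps its
   denominator positive. *)
exists (Num.min (e / L) (eps / (K * L ^+ 2 * S + 1))).
  by rewrite lt_min; apply/andP; split; exact: divr_gt0.
move=> h; rewrite lt_min => /andP[h1 h2].
have h0 : 0 <= vnorm h by rewrite sqrtr_ge0.
have tb j : cabs (- hdot h (a j)) <= L * vnorm h by rewrite cabsN; exact: cabs_hdot_le_norm.
have te j : cabs (- hdot h (a j)) <= e.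
  by apply: le_trans (tb j) _; rewrite mulrC -ler_pdivlMr// ltW.
have uh j : 1 - hdot (z + h) (a j) = u j + - hdot h (a j).
  by rewrite /u hdotDl opprD addrA.
have eu j : e + cabs (- hdot h (a j)) <= complex.Re (u j).
  by apply: le_trans (uE j); have := te j; rewrite /e; lra.
have sh : csummable (fun j => V j * cpowN s (u j + - hdot h (a j))).
  apply: (@csummable_cpowN s e) => [| //|j]; first exact: ltW.
  have := eu j; have := normr_Re_le (- hdot h (a j)).
  case: (u j) (- hdot h (a j)) => [x y] [x' y'] /=.
  by have := ler_norm (- x'); rewrite normrN; lra.
have sz := csummable_synth z1.
have sFh i : csummable (fun j => F i j * h ord0 i).
  rewrite (_ : (fun j => _) = fun j => h ord0 i * F i j); first exact: csummableZ.
  by apply/funext => j; rewrite mulrC.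
have [sL EL] := csum_sum sFh.
have -> : \sum_(j < n.+1) (\row_i csum (F i)) ord0 j * h ord0 j =
    csum (fun k => \sum_i F i k * h ord0 i).
  rewrite EL; apply: eq_bigr => i _; rewrite mxE mulrC -csumZ//; congr csum.
  by apply/funext => k; rewrite mulrC.
rewrite /synth; under eq_fun do rewrite uh.
rewrite -csumB// -csumB//; last by apply: csummableD => //; apply: (@le_csummable R 1) sz => k; rewrite mul1r cabsN.
set G := (fun k => _ - _).
have GE k : G k = V k * (cpowN s (u k + - hdot h (a k)) - cpowN s (u k) -
    Complex (- s) 0 * (- hdot h (a k)) * cpowN (s + 1) (u k)).
  rewrite /G !mulrBr; congr (_ - _).
  rewrite /hdot -sumrN mulr_sumr mulr_suml mulr_sumr; apply: eq_bigr => i _.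
  have -> : Complex (- s) 0 = - Complex s 0 :> C by apply/eqP; rewrite eq_complex /= oppr0 !eqxx.
  rewrite /F; ring.
have Gb k : cabs (G k) <= (K * (L * vnorm h) ^+ 2) * cabs (V k).
  rewrite GE cabsM mulrC ler_wpM2r ?cabs_ge0//.
  apply: le_trans (cpowN_taylor s0 e0 (eu k)) _.
  by rewrite -/K ler_wpM2l// ler_pXn2r ?nnegrE ?cabs_ge0// mulr_ge0// ltW.
have sG : csummable G by exact: le_csummable Gb sV.
rewrite -lee_fin; apply: le_trans (csum_cabs_le sG) _.
apply: (@le_trans _ _ ((K * (L * vnorm h) ^+ 2)%:E * l1norm V)%E).
  rewrite -nneseriesZl; last by move=> k _; rewrite lee_fin cabs_ge0.
  apply: lee_nneseries => [k _ _|k _]; first by rewrite lee_fin cabs_ge0.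
  by rewrite -EFinM lee_fin.
rewrite SE -EFinM lee_fin.
have -> : K * (L * vnorm h) ^+ 2 * S = (vnorm h * (K * L ^+ 2 * S)) * vnorm h by ring.
rewrite ler_wpM2r//.
move: h2; rewrite ltr_pdivlMr// => /ltW; apply: le_trans.
by rewrite ler_wpM2l// lerDl.
Qed.

(** The sum and the iterated integral are exchanged for the nonnegative measurable kernels. The
    integrand of [synth] enters only through pointwise domination: inside the ball by the triangle
    inequality for series, outside because the indicator is zero. *)
Lemma synth_integral_le (al : R) (M : \bar R) :
  (\sum_(j <oo) (cabs (V j))%:E *
     iint (2 * n.+1) (fun x => (kernel_integrand al s (a j) x)%:E) (fun=> 0%R) <= M)%E ->
  (ball_integral (fun z : 'rV[C]_n.+1 => ((1 - vnorm2 z) `^ al * cabs (synth z))%R) <= M)%E.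
Proof.
apply: le_trans.
under [leRHS]eq_eseriesr => j _.
  rewrite -iintZl; last first.
  - by move=> x; rewrite lee_fin kernel_integrand_ge0.
  - exact: cmeasurable_kernel_integrand.
  - exact: cabs_ge0.
  over.
rewrite -iint_nneseries; last first.
- by move=> j x; rewrite -EFinM lee_fin mulr_ge0 ?kernel_integrand_ge0 ?cabs_ge0.
- move=> j d T phi mphi; apply: measurable_funeM.
  exact: (cmeasurable_kernel_integrand al s (a j) mphi).
apply: le_iint => x; first by rewrite lee_fin !mulr_ge0 ?powR_ge0 ?cabs_ge0.
rewrite indicE; have [xB|xB] := boolP (cvec_of n.+1 x \in @ball_n R n.+1); last first.
  rewrite mul0r; apply: nneseries_ge0 => j _ _.
  by rewrite -EFinM lee_fin mulr_ge0 ?kernel_integrand_ge0 ?cabs_ge0.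
rewrite mul1r; move: xB; rewrite inE /ball_n /= => x1.
pose P j := V j * cpowN s (1 - hdot (cvec_of n.+1 x) (a j)).
pose r := (1 - vnorm2 (cvec_of n.+1 x)) `^ al.
rewrite EFinM; apply: (@le_trans _ _ (r%:E * l1norm P)%E).
  by rewrite lee_wpmul2l ?lee_fin ?powR_ge0//; apply: csum_cabs_le; exact: csummable_synth.
rewrite -nneseriesZl; last by move=> k _; rewrite lee_fin cabs_ge0.
apply: lee_nneseries => [k _ _|k _].
  by rewrite -EFinM lee_fin mulr_ge0 ?powR_ge0 ?cabs_ge0.
rewrite -!EFinM lee_fin cabsM cabs_cpowN /kernel_integrand -vnorm2_cvec posp_gt0E ?subr_gt0//.
by rewrite mulrCA.
Qed.

End synthesis.

(** * Choice of the weights, the matrix and the interpolating function *)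

Theorem theorem4p2 (R : realType) (n : nat) (alpha : R)
  (a : nat -> 'rV[complex R]_n) :
  (0 < n)%N ->
  -1 < alpha ->
  (forall k, @ball_n R n (a k)) ->
  separated_seq a ->
  (exists2 m : R, 0 < m & (Kconst a m (n%:R + 1 + alpha) < 1%:E)%E) ->
  interpolating_B1 alpha a.
Proof.
case: n a => // n a _ al1 a1 _ [m m0 K1] v sv.
set N := n.+1%:R + 1 + alpha in K1 sv.
have N0 : 0 < N by rewrite /N -natr1; have := ler0n R n; lra.
pose s := N + m; have s0 : 0 < s by rewrite addr_gt0.
pose d k := 1 - vnorm2 (a k).
have d0 k : 0 < d k by rewrite subr_gt0; exact: a1.
have d1 k : d k <= 1 by rewrite lerBlDr lerDl vnorm2_ge0.
pose F j (z : 'rV[complex R]_n.+1) := Complex (d j `^ s) 0 * cpowN s (1 - hdot z (a j)).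
have Fdiag k : F k (a k) = 1.
  rewrite /F hdot_self.
  have -> : 1 - Complex (vnorm2 (a k)) 0 = Complex (d k) 0 :> complex R.
    by apply/eqP; rewrite eq_complex /= subr0 !eqxx.
  rewrite cpowN_real//; apply/eqP; rewrite eq_complex /= !mul0r mulr0 addr0 subr0 eqxx andbT.
  by rewrite powRN divff// gt_eqF// powR_gt0.
have cabsF j z : cabs (F j z) = d j `^ s * cabs (1 - hdot z (a j)) `^ (- s).
  by rewrite /F cabsM cabs_real ger0_norm ?powR_ge0// cabs_cpowN cabs_powR mulNr.
pose W k := d k `^ N.
have W0 k : 0 < W k by rewrite powR_gt0.
pose A k j := if k != j then F j (a k) else 0.
have Kge j : (\sum_(k <oo | k != j) (Kterm a m N j k)%:E <= Kconst a m N)%E.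
  by apply: ereal_sup_ubound; exists j.
have Kt0 j k : 0 <= Kterm a m N j k by rewrite !mulr_ge0 ?invr_ge0 ?powR_ge0.
have K0 : (0 <= Kconst a m N)%E.
  by apply: le_trans (Kge 0%N); apply: nneseries_ge0 => k _ _; rewrite lee_fin.
pose q := fine (Kconst a m N).
have qE : Kconst a m N = q%:E.
  by rewrite /q fineK// ge0_fin_numE//; apply: lt_trans K1 _; rewrite ltry.
have q0 : 0 <= q by rewrite fine_ge0.
have q1 : q < 1 by rewrite -lte_fin -qE.
(* The column index [j] is the fixed index of [Kconst]: for k <> j, splitting (1 - |a_j|^2)^s into
   exponents N and m turns W_k |F_j(a_k)| into W_j times [Kterm a m N j k]. *)
have Aq j : (\sum_(k <oo) (W k * cabs (A k j))%:E <= (q * W j)%:E)%E.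
  apply: (@le_trans _ _ ((W j)%:E * \sum_(k <oo | k != j) (Kterm a m N j k)%:E)%E); last first.
    by rewrite mulrC EFinM lee_wpmul2l ?lee_fin ?(ltW (W0 j))// -qE.
  rewrite -nneseriesZl; last by move=> k _; rewrite lee_fin.
  rewrite [leRHS]eseries_mkcond; apply: lee_nneseries => [k _ _|k _].
    by rewrite lee_fin mulr_ge0 ?cabs_ge0 ?(ltW (W0 k)).
  rewrite /A; case: ifP => kj; last by rewrite cabs0 mulr0.
  rewrite -EFinM lee_fin cabsF /Kterm -/(d j) -/(d k) /W /s (gt0_powRD N m (d0 j)).
  rewrite powRN [N + m]addrC le_eqVlt; apply/orP; left; apply/eqP; ring.
have sv' : (wnorm W v < +oo)%E by rewrite wnormE.
have [w [sw wE]] := neumann W0 q0 q1 Aq sv'.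
pose V j := w j * Complex (d j `^ s) 0.
have cabsV j : cabs (V j) = d j `^ s * cabs (w j).
  by rewrite /V cabsM cabs_real ger0_norm ?powR_ge0// mulrC.
(* As 0 < d_j <= 1 and s >= N, the factor d_j^s is at most the weight d_j^N. *)
have sV : csummable V.
  apply: (@le_csummable _ 1) sw => j; rewrite mul1r cabsV cabsM cabs_real gtr0_norm//.
  by rewrite ler_wpM2r ?cabs_ge0// ger_powR ?d0 ?d1// lerDl ltW.
have a1' j : vnorm2 (a j) < 1 by exact: a1.
exists (synth a V s); split; first split.
- exact: holomorphic_synth.
- have [c c0 FR] := @forelli_rudin R n alpha m al1 m0.
  apply: (@le_lt_trans _ _ (c%:E * wnorm W w)%E); last first.
    have wf : wnorm W w \is a fin_num by rewrite ge0_fin_numE ?l1norm_ge0.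
    by rewrite -(fineK wf) -EFinM ltry.
  apply: synth_integral_le => //.
  rewrite wnormE// -nneseriesZl; last first.
    by move=> k _; rewrite lee_fin mulr_ge0 ?cabs_ge0 ?(ltW (W0 k)).
  apply: lee_nneseries => [j _ _|j _].
    by rewrite mule_ge0 ?lee_fin ?cabs_ge0//; apply: iint_ge0 => x; rewrite lee_fin kernel_integrand_ge0.
  (* The Forelli-Rudin factor d_j^(-m) cancels the excess of s over N, which leaves c W_j |w_j|. *)
  apply: (@le_trans _ _ ((cabs (V j))%:E * (c * d j `^ (- m))%:E)%E).
    by rewrite lee_wpmul2l ?lee_fin ?cabs_ge0//; exact: FR.
  rewrite -!EFinM lee_fin cabsV /W /s (gt0_powRD N m (d0 j)) powRN.
  rewrite le_eqVlt; apply/orP; left; apply/eqP; field.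
  by rewrite gt_eqF// powR_gt0.
- move=> k; rewrite -wE.
  have sf := csummable_synth a1' sV s0 (a1' k).
  have sA := matop_csummable W0 Aq k sw.
  (* Subtracting the off-diagonal series termwise leaves only the term j = k, which equals w_k
     because F_k(a_k) = 1; the equation solved by [w] then gives v_k. *)
  have -> : synth a V s (a k) = csum (fun j => V j * cpowN s (1 - hdot (a k) (a j)) - A k j * w j) +
      matop A w k.
    by rewrite csumB// subrK.
  congr (_ + _); rewrite (@csum_single _ k).
  + by rewrite /A eqxx mul0r subr0 /V -mulrA -/(F k (a k)) Fdiag mulr1.
  + apply: csummableD => //; apply: (@le_csummable _ 1) sA => j.
    by rewrite mul1r cabsN.
  + move=> j jk; rewrite /A eq_sym jk /V -mulrA -/(F j (a k)) mulrC subrr//.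
Qed.
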